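(* Let $P$ be a computable probability measure on the binary tree, and let $\omega$ be an infinite binary sequence that is Martin-Löf random with respect to $P$. Then \[ H(0\mid x)-P(0\mid x)\to 0 \] as $x$ ranges over the prefixes of $\omega$ and their length tends to infinity. Here $H(0\mid x)$ is the best-explanation prediction defined in the context.
   Context: A measure on the binary tree is a function $P:\{0,1\}^*\to\mathbb{R}_{\ge 0}$ with rational values such that $P(\text{empty word})=1$ and $P(x0)+P(x1)=P(x)$ for every string $x$. It is computable if some algorithm outputs $P(x)$ on input $x$. Conditional probabilities are $P(b\mid x)=P(xb)/P(x)$. $K$ denotes prefix complexity, and $K(Q)$ for a computable measure $Q$ is the minimal prefix complexity of a program computing $Q$. Logarithms are binary. For a string $x$, a best explanation of $x$ is a computable measure $Q$ minimizing $3K(Q)-\log Q(x)$ over all computable measures; any one minimizer is chosen. The prediction is $H(b\mid x)=Q(xb)/Q(x)$ for this chosen $Q$. *)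

(* Defs.v *)
From Stdlib Require Import Reals.
From HB Require Import structures.
From mathcomp Require Import all_boot all_order all_algebra.
From mathcomp Require Import boolp.
From mathcomp Require Import Rstruct.

Set Implicit Arguments.
Unset Strict Implicit.
Unset Printing Implicit Defensive.

Import Order.TTheory GRing.Theory Num.Theory.

Definition npair (a b : nat) : nat := (2 ^ a * b.*2.+1).-1.
Definition nfst (n : nat) : nat := logn 2 n.+1.
Definition nsnd (n : nat) : nat := (n.+1 %/ 2 ^ (nfst n))./2.

Inductive code : Type :=
| CZero : code
| CSucc : code
| CId   : code
| CFst  : code
| CSnd  : code
| CComp : code -> code -> code
| CPair : code -> code -> code
| CRec  : code -> code -> code
| CMu   : code -> code.

Fixpoint eval (k : nat) (c : code) (x : nat) {struct k} : option nat :=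
  match k with
  | 0 => None
  | k'.+1 =>
    match c with
    | CZero => Some 0
    | CSucc => Some x.+1
    | CId => Some x
    | CFst => Some (nfst x)
    | CSnd => Some (nsnd x)
    | CComp f g => obind (eval k' f) (eval k' g x)
    | CPair f g =>
        match eval k' f x, eval k' g x with
        | Some a, Some b => Some (npair a b)
        | _, _ => None
        end
    | CRec f g =>
        let a := nfst x in
        (fix loop (m : nat) : option nat :=
           match m with
           | 0 => eval k' f a
           | m'.+1 => obind (fun r => eval k' g (npair a (npair m' r))) (loop m')
           end) (nsnd x)
    | CMu f =>
        (fix srch (j i : nat) {struct j} : option nat :=
           match j with
           | 0 => None
           | j'.+1 =>
             match eval k' f (npair x i) with
             | Some 0 => Some i
             | Some _ => srch j' i.+1
             | None => None
             end
           end) k' 0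
    end
  end.

Definition runs (c : code) (x y : nat) : Prop := exists k, eval k c x = Some y.

Fixpoint enc_code (c : code) : nat :=
  match c with
  | CZero => npair 0 0
  | CSucc => npair 1 0
  | CId => npair 2 0
  | CFst => npair 3 0
  | CSnd => npair 4 0
  | CComp f g => npair 5 (npair (enc_code f) (enc_code g))
  | CPair f g => npair 6 (npair (enc_code f) (enc_code g))
  | CRec f g => npair 7 (npair (enc_code f) (enc_code g))
  | CMu f => npair 8 (enc_code f)
  end.

Fixpoint enc_bits (s : seq bool) : nat :=
  match s with
  | [::] => 0
  | b :: s' => (npair (nat_of_bool b) (enc_bits s')).+1
  end.

Definition enc_int (z : int) : nat :=
  match z with Posz n => n.*2 | Negz n => n.*2.+1 end.

Definition enc_rat (q : rat) : nat := npair (enc_int (numq q)) (enc_int (denq q)).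

Definition machine := seq bool -> option nat.

Definition partial_computable (M : machine) : Prop :=
  exists c : code, forall (p : seq bool) (n : nat),
    M p = Some n <-> runs c (enc_bits p) n.

Definition prefix_free (M : machine) : Prop :=
  forall p q : seq bool, M p <> None -> M q <> None -> prefix p q -> p = q.

Definition optimal_prefix_machine (U : machine) : Prop :=
  [/\ prefix_free U, partial_computable U &
      forall M : machine, prefix_free M -> partial_computable M ->
        exists c : nat, forall p n, M p = Some n ->
          exists p', U p' = Some n /\ size p' <= size p + c].

Local Open Scope ring_scope.

(* bit 0 = false, bit 1 = true; "x b" is rcons x b *)
Definition is_measure (Q : seq bool -> rat) : Prop :=
  [/\ Q [::] = 1,
      forall x, 0 <= Q x &
      forall x, Q (rcons x false) + Q (rcons x true) = Q x].

Definition computes (c : code) (Q : seq bool -> rat) : Prop :=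
  forall x, runs c (enc_bits x) (enc_rat (Q x)).

Definition computable_measure (Q : seq bool -> rat) : Prop :=
  is_measure Q /\ exists c, computes c Q.

Definition KQ (U : machine) (Q : seq bool -> rat) (k : nat) : Prop :=
  (exists c p, computes c Q /\ U p = Some (enc_code c) /\ size p = k) /\
  (forall c p, computes c Q -> U p = Some (enc_code c) -> (k <= size p)%N).

Definition log2 (r : R) : R := (ln r / ln 2)%R.

(* the quantity 3K(Q) - log Q(x) for Q(x) > 0 (it is +oo when Q(x) = 0) *)
Definition score (k : nat) (q : rat) : R := (3 * INR k - log2 (ratr q))%R.

(* Q is a best explanation of x: a minimizer of 3K(Q) - log Q(x) over all
   computable measures (with -log 0 = +oo). *)
Definition best_explanation (U : machine) (x : seq bool) (Q : seq bool -> rat) : Prop :=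
  computable_measure Q /\ 0 < Q x /\
  exists k, KQ U Q k /\
    forall Q' k', computable_measure Q' -> KQ U Q' k' -> 0 < Q' x ->
      (score k (Q x) <= score k' (Q' x))%R.

Definition cond (Q : seq bool -> rat) (b : bool) (x : seq bool) : rat :=
  Q (rcons x b) / Q x.

Definition prefix_of (w : nat -> bool) (n : nat) : seq bool := mkseq w n.

Definition test_set (t : code) (k : nat) (x : seq bool) : Prop :=
  exists y, runs t (npair k (enc_bits x)) y.

(* P-measure of the open set generated by U_k: sup over n of the P-mass of
   strings of length n having a prefix in U_k. *)
Definition ML_test (P : seq bool -> rat) (t : code) : Prop :=
  forall (k n : nat),
    \sum_(s : n.-tuple bool | `[< exists y, prefix y (tval s) /\ test_set t k y >])
       P (tval s) <= (2 ^ k)%:R^-1.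

Definition ML_random (P : seq bool -> rat) (w : nat -> bool) : Prop :=
  forall t, ML_test P t ->
    exists k, forall m, ~ test_set t k (prefix_of w m).

(* Main.v *)
(* If Q is the best explanation of x, comparing its score with that of P gives
   2^(3K(Q)) P(x) <= 2^(3K(P)) Q(x).  A universal Martin-Löf test, which runs all
   programs p of candidate measures Q in parallel and accepts x when
   Q(x) > 2^(k + 2|p| + 1) P(x), gives Q(x) <= O(2^(2K(Q))) P(x) along the random
   sequence; hence K(Q) stays bounded, only finitely many measures occur as best
   explanations, and Q/P is bounded below whenever Q is one of them.

   For a fixed such Q let R be the measure whose conditional probabilities are the
   averages of those of P and Q.  By AM-GM, (R/P)^2 >= (Q/P) (1 + eps^2/4)^g,
   where g counts the prefixes at which the predictions of P and Q differ by at
   least eps.  As R is a computable measure, the universal test bounds R/P along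
   the sequence, so g stays bounded. *)
Require Import Defs.
From Stdlib Require Import Reals.
From mathcomp Require Import all_boot all_order all_algebra.
From mathcomp Require Import boolp Rstruct.
From mathcomp Require Import zify ring lra.

Set Implicit Arguments.
Unset Strict Implicit.
Unset Printing Implicit Defensive.

Import Order.TTheory GRing.Theory Num.Theory.

Local Open Scope nat_scope.

(** * Computable functions *)

(** The test has to be semi-decidable, whereas being a program of a measure is not. The test
    therefore checks the measure inequalities only at the prefixes of x, which takes finitely many
    halting computations. In the mass estimate the values of a program are replaced by 0 from the
    first violation on; every program then yields a supermartingale, and Ville's inequality applies.
    Asking for inequalities only also admits R, which loses mass where P or Q vanishes. The weights
    are summed over all words p: the 2^l words of length l, with weight 2^(-2l-1) each, contribute
    2^(-l-1). This costs 2K(Q) in the bound on Q/P, and the coefficient 3 in the score leaves one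
    K(Q) to be bounded. Arithmetic averages, unlike geometric ones, keep R rational-valued and
    computable. The best explanation may change with x. If gaps recur forever, a pigeonhole over
    programs of bounded length yields one Q that explains infinitely many prefixes with a gap, and
    for this Q the count g is unbounded. *)

Lemma nfst_npair a b : nfst (npair a b) = a.
Proof.
rewrite /nfst /npair prednK ?muln_gt0 ?expn_gt0 //.
rewrite lognM ?expn_gt0 // pfactorK // lognE /=.
by rewrite dvdn2 /= odd_double /= addn0.
Qed.

Lemma nsnd_npair a b : nsnd (npair a b) = b.
Proof.
rewrite /nsnd nfst_npair /npair prednK ?muln_gt0 ?expn_gt0 //.
by rewrite mulKn ?expn_gt0 //= uphalf_double.
Qed.

Definition npairE := (nfst_npair, nsnd_npair).

Lemma leq_npair a b : b <= npair a b.
Proof.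
rewrite /npair -ltnS prednK ?muln_gt0 ?expn_gt0 //.
have : 0 < 2 ^ a by rewrite expn_gt0.
by nia.
Qed.

(* [rec_loop] and [mu_loop] are the local fixpoints in the definition of [eval]. *)
Definition rec_loop (F G : nat -> option nat) (a : nat) : nat -> option nat :=
  fix loop m :=
    match m with
    | 0 => F a
    | m'.+1 => obind (fun r => G (npair a (npair m' r))) (loop m')
    end.

Definition mu_loop (F : nat -> option nat) (x : nat) : nat -> nat -> option nat :=
  fix srch j i {struct j} :=
    match j with
    | 0 => None
    | j'.+1 =>
      match F (npair x i) with
      | Some 0 => Some i
      | Some _ => srch j' i.+1
      | None => None
      end
    end.

Lemma eval_rec k f g x :
  eval k.+1 (CRec f g) x = rec_loop (eval k f) (eval k g) (nfst x) (nsnd x).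
Proof. by []. Qed.

Lemma eval_mu k f x : eval k.+1 (CMu f) x = mu_loop (eval k f) x k 0.
Proof. by []. Qed.

Lemma rec_loop_mono (F F' G G' : nat -> option nat) a m y :
  (forall x z, F x = Some z -> F' x = Some z) ->
  (forall x z, G x = Some z -> G' x = Some z) ->
  rec_loop F G a m = Some y -> rec_loop F' G' a m = Some y.
Proof.
move=> FF' GG'; elim: m y => [|m IHm] y /=; first exact: FF'.
case E: (rec_loop F G a m) => [r|] //=; rewrite (IHm _ E) /=; exact: GG'.
Qed.

Lemma eval_leq k k' c x y :
  k <= k' -> eval k c x = Some y -> eval k' c x = Some y.
Proof.
elim: k k' c x y => [//|k IH] [//|k'] c x y le_kk'.
have {}IH c' x' y' := IH k' c' x' y' le_kk'.
case: c => //.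
- move=> f g /=; case E: (eval k g x) => [z|] //= Ef.
  by rewrite (IH _ _ _ E) /=; apply: IH.
- move=> f g /=; case E: (eval k f x) => [z|] //; case E': (eval k g x) => [z'|] //.
  by rewrite (IH _ _ _ E) (IH _ _ _ E').
- by move=> f g; rewrite !eval_rec; apply: rec_loop_mono => *; apply: IH.
- move=> f; rewrite !eval_mu.
  (* Fuel plays two roles in [CMu], depth of evaluation and number of candidates; only the second is
     generalized for the induction. *)
  have: k <= k' by [].
  move: {1 3}k {1 3}k'.
  move=> j j'; elim: j j' 0 => [//|j IHj] [//|j'] i le_jj' /=.
  case E: (eval k f _) => [[|r]|] //; rewrite (IH _ _ _ E) //.
  exact: IHj.
Qed.

Lemma runs_fun c x y z : runs c x y -> runs c x z -> y = z.
Proof.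
move=> [k Ek] [k' Ek'].
have := eval_leq (leq_maxl k k') Ek; rewrite (eval_leq (leq_maxr k k') Ek').
by case.
Qed.

Lemma runs_comp f g x y z : runs g x y -> runs f y z -> runs (CComp f g) x z.
Proof.
move=> [k Ek] [k' Ek']; exists (maxn k k').+1 => /=.
by rewrite (eval_leq (leq_maxl k k') Ek) /= (eval_leq (leq_maxr k k') Ek').
Qed.

Lemma runs_pair f g x y z :
  runs f x y -> runs g x z -> runs (CPair f g) x (npair y z).
Proof.
move=> [k Ek] [k' Ek']; exists (maxn k k').+1 => /=.
by rewrite (eval_leq (leq_maxl k k') Ek) /= (eval_leq (leq_maxr k k') Ek').
Qed.

Lemma runs_rec f g x h :
  runs f (nfst x) (h 0) ->
  (forall m, m < nsnd x -> runs g (npair (nfst x) (npair m (h m))) (h m.+1)) ->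
  runs (CRec f g) x (h (nsnd x)).
Proof.
move=> runs0 runsS.
suff [k Ek] : exists k,
    rec_loop (eval k f) (eval k g) (nfst x) (nsnd x) = Some (h (nsnd x)).
  by exists k.+1.
elim: (nsnd x) runsS => [_|m IHm runsS]; first exact: runs0.
have [|k Ek] := IHm; first by move=> i lt_im; apply: runsS; apply: leqW.
have [k' Ek'] := runsS m (leqnn _).
exists (maxn k k') => /=.
rewrite (rec_loop_mono _ _ Ek) /= => [|z z'|z z'].
- exact: eval_leq (leq_maxr k k') Ek'.
- exact/eval_leq/leq_maxl.
- exact/eval_leq/leq_maxl.
Qed.

Lemma runs_mu f x g :
  (forall i, runs f (npair x i) (g i)) ->
  (exists y, runs (CMu f) x y) <-> (exists j, g j = 0).
Proof.
move=> runs_f; split=> [[y [[//|k]]]|].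
  rewrite eval_mu; have eval_g i r : eval k f (npair x i) = Some r -> r = g i.
    by move=> Er; apply: (runs_fun _ (runs_f i)); exists k.
  move: {2}k => j; elim: j {1}0 => [//|j IHj] i /=.
  case E: (eval k f _) => [[|r]|] // H; last exact: IHj H.
  by exists i; rewrite -(eval_g _ _ E).
move=> ex_j; have {ex_j}: exists j, g j == 0 by case: ex_j => j /eqP; exists j.
case/ex_minnP => j /eqP gj j_min.
have [k lt_jk Ek] : exists2 k, j < k &
    forall i, i <= j -> eval k f (npair x i) = Some (g i).
  elim: (j) => [|m [k lt_jk IHm]].
    have [k Ek] := runs_f 0; exists (maxn k 1); first exact: leq_maxr.
    by case=> // _; apply: eval_leq Ek; apply: leq_maxl.
  have [k' Ek'] := runs_f m.+1; exists (maxn k k').+1.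
    exact: leq_trans lt_jk (leq_maxl _ _).
  move=> i; rewrite leq_eqVlt => /orP [/eqP ->|lt_im].
    by apply: eval_leq Ek'; apply/leqW/leq_maxr.
  by apply: eval_leq (IHm _ _) => //; apply/leqW/leq_maxl.
exists j, k.+1; rewrite eval_mu.
have: j < 0 + k by [].
move: {1 3}k 0 (leq0n j) => l i; elim: l i => [|l IHl] i le_ij.
  by rewrite addn0 ltnNge le_ij.
move=> lt_jil /=; rewrite Ek //.
move: le_ij; rewrite leq_eqVlt => /orP [/eqP ->|lt_ij]; first by rewrite gj.
case E: (g i) => [|r].
  by have := j_min i; rewrite E leqNgt lt_ij => /(_ isT).
by apply: IHl => //; rewrite addSnnS.
Qed.

(** Inputs come from any type through a coding, so that the body of a loop can be treated over
    [enc2], which appends an index or an accumulator to the parameters. *)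
Definition computable (A : Type) (enc f : A -> nat) : Prop :=
  exists c, forall a, runs c (enc a) (f a).

Definition enc2 (A : Type) (enc : A -> nat) (u : A * nat) : nat :=
  npair (enc u.1) u.2.

Lemma computable_ext (A : Type) (enc f g : A -> nat) :
  f =1 g -> computable enc f -> computable enc g.
Proof. by move=> eq_fg [c cP]; exists c => a; rewrite -eq_fg. Qed.

Lemma computable_enc (A : Type) (enc : A -> nat) : computable enc enc.
Proof. by exists CId => a; exists 1. Qed.

Lemma computable_comp_enc (A B : Type) (enc : A -> nat) (encB : B -> nat)
    (F : B -> nat) (h : A -> B) :
  computable encB F -> computable enc (fun a => encB (h a)) ->
  computable enc (fun a => F (h a)).
Proof. by move=> [c cP] [d dP]; exists (CComp c d) => a; apply: runs_comp. Qed.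

Lemma computable_comp (A : Type) (enc : A -> nat) (F : nat -> nat) (f : A -> nat) :
  computable id F -> computable enc f -> computable enc (fun a => F (f a)).
Proof. exact: computable_comp_enc. Qed.

Lemma computable_const (A : Type) (enc : A -> nat) (m : nat) : computable enc (fun=> m).
Proof.
elim: m => [|m [c cP]]; first by exists CZero => a; exists 1.
by exists (CComp CSucc c) => a; apply: runs_comp (cP a) _; exists 1.
Qed.

Lemma computable_S (A : Type) (enc f : A -> nat) :
  computable enc f -> computable enc (fun a => (f a).+1).
Proof. by apply: (computable_comp (F := S)); exists CSucc => a; exists 1. Qed.

Lemma computable_nfst (A : Type) (enc f : A -> nat) :
  computable enc f -> computable enc (fun a => nfst (f a)).
Proof. by apply: (computable_comp (F := nfst)); exists CFst => a; exists 1. Qed.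

Lemma computable_nsnd (A : Type) (enc f : A -> nat) :
  computable enc f -> computable enc (fun a => nsnd (f a)).
Proof. by apply: (computable_comp (F := nsnd)); exists CSnd => a; exists 1. Qed.

Lemma computable_npair (A : Type) (enc f g : A -> nat) :
  computable enc f -> computable enc g ->
  computable enc (fun a => npair (f a) (g a)).
Proof. by move=> [c cP] [d dP]; exists (CPair c d) => a; apply: runs_pair. Qed.

Lemma computable_iteri (A : Type) (enc n f : A -> nat) (G : A -> nat -> nat -> nat) :
  computable enc n -> computable enc f ->
  computable (enc2 (enc2 enc)) (fun u => G u.1.1 u.1.2 u.2) ->
  computable enc (fun a => iteri (n a) (G a) (f a)).
Proof.
move=> [cn cnP] [c cP] [d dP].
(* [CRec] passes its data as (a, (m, r)), while [enc2 (enc2 enc)] expects ((a, m), r). *)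
pose swap := CPair (CPair CFst (CComp CFst CSnd)) (CComp CSnd CSnd).
exists (CComp (CRec c (CComp d swap)) (CPair CId cn)) => a.
apply: (@runs_comp _ _ _ (npair (enc a) (n a))).
  by apply: runs_pair => //; exists 1.
have := @runs_rec c (CComp d swap) (npair (enc a) (n a))
  (fun m => iteri m (G a) (f a)).
rewrite !npairE; apply=> [|m _]; first exact: cP.
apply: runs_comp (dP (a, m, iteri m (G a) (f a))).
by exists 4; rewrite /enc2 /= !npairE.
Qed.

Lemma computable_lift2 (A : Type) (enc f : A -> nat) : computable enc f ->
  computable (enc2 enc) (fun u => f u.1).
Proof.
move=> [c cP]; exists (CComp c CFst) => -[a i].
by apply: runs_comp (cP a); exists 1; rewrite /= nfst_npair.
Qed.

Lemma computable_snd2 (A : Type) (enc : A -> nat) : computable (enc2 enc) snd.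
Proof. by exists CSnd => -[a i]; exists 1; rewrite /= nsnd_npair. Qed.

(** A loop of length [b a] whose body always returns [g a] leaves the initial [f a] untouched only
    when it has no rounds. *)
Lemma computable_if (A : Type) (enc b f g : A -> nat) :
  computable enc b -> computable enc f -> computable enc g ->
  computable enc (fun a => if b a == 0 then f a else g a).
Proof.
move=> cb cf cg.
suff: computable enc (fun a => iteri (b a) (fun _ _ => g a) (f a)).
  by apply: computable_ext => a; case: (b a).
apply: (computable_iteri (G := fun a _ _ => g a)) => //.
exact: (computable_lift2 (computable_lift2 cg)).
Qed.

Lemma computable_pred (A : Type) (enc f : A -> nat) :
  computable enc f -> computable enc (fun a => (f a).-1).
Proof.
apply: (computable_comp (F := predn)).
suff: computable id (fun a => iteri a (fun i _ => i) 0).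
  by apply: computable_ext; case.
apply: (computable_iteri (G := fun _ i _ => i));
  [exact: computable_enc | exact: computable_const |].
exact/computable_lift2/computable_snd2.
Qed.

Lemma computable_add (A : Type) (enc f g : A -> nat) :
  computable enc f -> computable enc g ->
  computable enc (fun a => f a + g a).
Proof.
move=> cf cg.
suff: computable enc (fun a => iteri (g a) (fun _ r => r.+1) (f a)).
  apply: computable_ext => a; elim: (g a) => [|m /= ->]; by rewrite ?addn0 ?addnS.
apply: (computable_iteri (G := fun _ _ r => r.+1)) => //.
exact/computable_S/computable_snd2.
Qed.

Lemma computable_sub (A : Type) (enc f g : A -> nat) :
  computable enc f -> computable enc g ->
  computable enc (fun a => f a - g a).
Proof.
move=> cf cg.
suff: computable enc (fun a => iteri (g a) (fun _ r => r.-1) (f a)).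
  apply: computable_ext => a; elim: (g a) => [|m /= ->]; by rewrite ?subn0 ?subnS.
apply: (computable_iteri (G := fun _ _ r => r.-1)) => //.
exact/computable_pred/computable_snd2.
Qed.

Lemma computable_sum (A : Type) (enc n : A -> nat) (F : A -> nat -> nat) :
  computable enc n -> computable (enc2 enc) (fun u => F u.1 u.2) ->
  computable enc (fun a => \sum_(i < n a) F a i).
Proof.
move=> cn cF.
suff: computable enc (fun a => iteri (n a) (fun i r => F a i + r) 0).
  apply: computable_ext => a; elim: (n a) => [|m /= ->]; first by rewrite big_ord0.
  by rewrite big_ord_recr /= addnC.
apply: (computable_iteri (G := fun a i r => F a i + r)) => //.
  exact: computable_const.
apply: computable_add (computable_snd2 _).
exact: (computable_lift2 cF).
Qed.

Lemma computable_mul (A : Type) (enc f g : A -> nat) :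
  computable enc f -> computable enc g ->
  computable enc (fun a => f a * g a).
Proof.
move=> cf cg.
suff: computable enc (fun a => \sum_(i < g a) f a).
  by apply: computable_ext => a; rewrite sum_nat_const card_ord mulnC.
exact/(computable_sum (F := fun a _ => f a))/computable_lift2.
Qed.

Lemma computable_prod (A : Type) (enc n : A -> nat) (F : A -> nat -> nat) :
  computable enc n -> computable (enc2 enc) (fun u => F u.1 u.2) ->
  computable enc (fun a => \prod_(i < n a) F a i).
Proof.
move=> cn cF.
suff: computable enc (fun a => iteri (n a) (fun i r => F a i * r) 1).
  apply: computable_ext => a; elim: (n a) => [|m /= ->]; first by rewrite big_ord0.
  by rewrite big_ord_recr /= mulnC.
apply: (computable_iteri (G := fun a i r => F a i * r)) => //.
  exact: computable_const.
apply: computable_mul (computable_snd2 _).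
exact: (computable_lift2 cF).
Qed.

Lemma computable_iter (A : Type) (enc n f : A -> nat) (F : nat -> nat) :
  computable enc n -> computable id F -> computable enc f ->
  computable enc (fun a => iter (n a) F (f a)).
Proof.
move=> cn cF cf.
suff: computable enc (fun a => iteri (n a) (fun _ => F) (f a)).
  by apply: computable_ext => a; elim: (n a) => //= m ->.
apply: (computable_iteri (G := fun _ _ => F)) => //.
exact/(computable_comp cF)/computable_snd2.
Qed.

Lemma computable_exp2 (A : Type) (enc f : A -> nat) :
  computable enc f -> computable enc (fun a => 2 ^ f a).
Proof.
move=> cf.
suff: computable enc (fun a => \prod_(i < f a) 2).
  by apply: computable_ext => a; rewrite prod_nat_const card_ord.
by apply: (computable_prod (F := fun _ _ => 2)) => //; apply: computable_const.
Qed.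

Ltac computability_user := fail.

Ltac computability_step :=
  lazymatch goal with
  | |- computable _ (fun _ => ?m) => apply: computable_const
  | |- computable _ (fun a => S _) => apply: computable_S
  | |- computable _ (fun a => predn _) => apply: computable_pred
  | |- computable _ (fun a => nfst _) => apply: computable_nfst
  | |- computable _ (fun a => nsnd _) => apply: computable_nsnd
  | |- computable _ (fun a => npair _ _) => apply: computable_npair
  | |- computable _ (fun a => addn _ _) => apply: computable_add
  | |- computable _ (fun a => muln _ _) => apply: computable_mul
  | |- computable _ (fun a => subn _ _) => apply: computable_sub
  | |- computable _ (fun a => expn 2 _) => apply: computable_exp2
  | |- computable _ (fun a => if _ == 0 then _ else _) => apply: computable_if
  | |- computable _ nfst => apply: (computable_nfst (f := fun a => a))
  | |- computable _ nsnd => apply: (computable_nsnd (f := fun a => a))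
  | |- computable _ predn => apply: (computable_pred (f := fun a => a))
  | |- computable _ S => apply: (computable_S (f := fun a => a))
  | |- computable _ snd => apply: computable_snd2
  | |- computable id (fun a => a) => apply: computable_enc
  | |- computable (enc2 _) (fun a => a.2) => apply: computable_snd2
  | |- _ => first [assumption | computability_user
                  | apply: (computable_lift2 (f := fun a => _))]
  end.
Ltac computability := repeat computability_step.

(** * A universal machine *)

(* The stack [K] is a list of frames [push t d K]. On the return of a value [v],
   the frame calls [d] on [v] (t = 1), computes the second component of a pair
   (t = 2), pairs [d] with [v] (t = 3), continues a recursion (t = 4) or continues
   a search (t = 5); [K = 0] acts as a frame of tag 0, which halts. *)
Definition st_eval (e x K : nat) : nat := npair 0 (npair e (npair x K)).
Definition st_return (v K : nat) : nat := npair 1 (npair v K).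
Definition push (t d K : nat) : nat := npair t (npair d K).

Definition step_eval (e x K : nat) : nat :=
  if nfst e == 0 then st_return 0 K
  else if (nfst e).-1 == 0 then st_return x.+1 K
  else if (nfst e).-2 == 0 then st_return x K
  else if (nfst e).-2.-1 == 0 then st_return (nfst x) K
  else if (nfst e).-2.-2 == 0 then st_return (nsnd x) K
  else if (nfst e).-2.-2.-1 == 0 then
    st_eval (nsnd (nsnd e)) x (push 1 (nfst (nsnd e)) K)
  else if (nfst e).-2.-2.-2 == 0 then
    st_eval (nfst (nsnd e)) x (push 2 (npair (nsnd (nsnd e)) x) K)
  else if (nfst e).-2.-2.-2.-1 == 0 then
    st_eval (nfst (nsnd e)) (nfst x)
      (push 4 (npair (nsnd (nsnd e)) (npair (nfst x) (npair 0 (nsnd x)))) K)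
  else st_eval (nsnd e) (npair x 0) (push 5 (npair (nsnd e) (npair x 0)) K).

Definition step_return (v K t d K' : nat) : nat :=
  if t == 0 then st_return v K
  else if t.-1 == 0 then st_eval d v K'
  else if t.-2 == 0 then st_eval (nfst d) (nsnd d) (push 3 v K')
  else if t.-2.-1 == 0 then st_return (npair d v) K'
  else if t.-2.-2 == 0 then
    if nsnd (nsnd (nsnd d)) - nfst (nsnd (nsnd d)) == 0 then st_return v K'
    else st_eval (nfst d)
      (npair (nfst (nsnd d)) (npair (nfst (nsnd (nsnd d))) v))
      (push 4 (npair (nfst d) (npair (nfst (nsnd d))
        (npair (nfst (nsnd (nsnd d))).+1 (nsnd (nsnd (nsnd d)))))) K')
  else
    if v == 0 then st_return (nsnd (nsnd d)) K'
    else st_eval (nfst d) (npair (nfst (nsnd d)) (nsnd (nsnd d)).+1)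
      (push 5 (npair (nfst d) (npair (nfst (nsnd d)) (nsnd (nsnd d)).+1)) K').

Definition step (s : nat) : nat :=
  if nfst s == 0 then
    step_eval (nfst (nsnd s)) (nfst (nsnd (nsnd s))) (nsnd (nsnd (nsnd s)))
  else step_return (nfst (nsnd s)) (nsnd (nsnd s)) (nfst (nsnd (nsnd s)))
    (nfst (nsnd (nsnd (nsnd s)))) (nsnd (nsnd (nsnd (nsnd s)))).

Lemma computable_step : computable id step.
Proof.
rewrite /step /step_eval /step_return /push /st_eval /st_return.
by computability.
Qed.

Lemma step_st_eval e x K : step (st_eval e x K) = step_eval e x K.
Proof. by rewrite /step /st_eval !npairE. Qed.

Lemma step_st_return v t d K :
  step (st_return v (push t d K)) = step_return v (push t d K) t d K.
Proof. by rewrite /step /st_return /push !npairE. Qed.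

Definition reaches (s s' : nat) : Prop := exists n, iter n step s = s'.

Lemma reaches_refl s : reaches s s.
Proof. by exists 0. Qed.

Lemma reaches_trans s1 s2 s3 : reaches s1 s2 -> reaches s2 s3 -> reaches s1 s3.
Proof. by move=> [n <-] [m <-]; exists (m + n); rewrite iterD. Qed.

Lemma reaches_step s s' : reaches (step s) s' -> reaches s s'.
Proof. by apply: reaches_trans; exists 1. Qed.

(** The machine follows [eval]. Numbers that code no program may halt on it as well; the test
    tolerates this, since its mass bound holds for whatever the machine outputs. *)
Lemma eval_reaches k c x y K :
  eval k c x = Some y -> reaches (st_eval (enc_code c) x K) (st_return y K).
Proof.
elim: k c x y K => [//|k IH] c x y K.
case: c => [||||| f g | f g | f g | f] E; apply: reaches_step;
  rewrite step_st_eval /step_eval /enc_code -/enc_code !npairE /=;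
  try by case: E => ->; apply: reaches_refl.
- move: E => /=; case Eg: (eval k g x) => [z|] //= Ef.
  apply: reaches_trans (IH _ _ _ _ Eg) _.
  by apply: reaches_step; rewrite step_st_return; apply: IH.
- move: E => /=; case Ef: (eval k f x) => [z|] //.
  case Eg: (eval k g x) => [z'|] // [<-].
  apply: reaches_trans (IH _ _ _ _ Ef) _.
  apply: reaches_step; rewrite step_st_return /step_return !npairE /=.
  apply: reaches_trans (IH _ _ _ _ Eg) _.
  by apply: reaches_step; rewrite step_st_return; apply: reaches_refl.
- move: E; rewrite eval_rec; move: (nfst x) (nsnd x) => a M.
  have loopP m z : m <= M -> rec_loop (eval k f) (eval k g) a m = Some z ->
      reaches (st_eval (enc_code f) a
          (push 4 (npair (enc_code g) (npair a (npair 0 M))) K))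
        (st_return z (push 4 (npair (enc_code g) (npair a (npair m M))) K)).
    elim: m z => [|m IHm] z le_mM /=; first by move/IH.
    case Em: (rec_loop _ _ a m) => [r|] //= Eg.
    apply: reaches_trans (IHm _ (ltnW le_mM) Em) _.
    apply: reaches_step; rewrite step_st_return /step_return !npairE /=.
    rewrite subn_eq0 leqNgt le_mM; exact: IH.
  move=> /loopP => /(_ (leqnn _)) E; apply: reaches_trans E _.
  apply: reaches_step; rewrite step_st_return /step_return !npairE /= subnn.
  exact: reaches_refl.
- move: E; rewrite eval_mu.
  suff: forall j i, mu_loop (eval k f) x j i = Some y ->
      reaches (st_eval (enc_code f) (npair x i)
        (push 5 (npair (enc_code f) (npair x i)) K)) (st_return y K).
    by apply.
  elim=> [//|j IHj] i /=.
  case Ef: (eval k f _) => [[|v]|] //.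
    move=> [<-]; apply: reaches_trans (IH _ _ _ _ Ef) _.
    apply: reaches_step; rewrite step_st_return /step_return !npairE /=.
    exact: reaches_refl.
  move=> /IHj Ej; apply: reaches_trans (IH _ _ _ _ Ef) _.
  by apply: reaches_step; rewrite step_st_return /step_return !npairE /=; apply: Ej.
Qed.

(* The output of program [e] on input [x] within [s] steps, shifted by one:
   the value 0 means that the computation has not halted. *)
Definition run (e x s : nat) : nat :=
  if nfst (iter s step (st_eval e x 0)) == 0 then 0
  else if nsnd (nsnd (iter s step (st_eval e x 0))) == 0 then
    (nfst (nsnd (iter s step (st_eval e x 0)))).+1
  else 0.

Lemma computable_run (A : Type) (enc e x s : A -> nat) :
  computable enc e -> computable enc x -> computable enc s ->
  computable enc (fun a => run (e a) (x a) (s a)).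
Proof.
move=> ce cx cs.
have cst : computable enc (fun a => iter (s a) step (st_eval (e a) (x a) 0)).
  apply: computable_iter => //; first exact: computable_step.
  by rewrite /st_eval; computability.
by rewrite /run; computability.
Qed.

Lemma run_leq e x s s' v : s <= s' -> run e x s = v.+1 -> run e x s' = v.+1.
Proof.
move=> /subnK <-; elim: (s' - s) => [//|n IHn] /IHn.
rewrite /run addSn iterS; move: (iter _ _ _) => st.
case: eqP => // /eqP st0; case: eqP => // st1 [<-].
rewrite /step (negPf st0) st1 /step_return.
have -> : nfst 0 = 0 by rewrite /nfst logn1.
by rewrite /st_return !npairE.
Qed.

Lemma run_fun e x s s' v v' : run e x s = v.+1 -> run e x s' = v'.+1 -> v = v'.
Proof.
move=> /(run_leq (leq_maxl s s')) E /(run_leq (leq_maxr s s')).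
by rewrite E => -[].
Qed.

Lemma runs_run c x y : runs c x y -> exists s, run (enc_code c) x s = y.+1.
Proof.
move=> [k /(eval_reaches 0) [s Es]]; exists s.
by rewrite /run Es /st_return !npairE.
Qed.

(* The output of [e] on [x], with junk value 0 if the computation diverges. *)
Definition output (e x : nat) : nat :=
  if pselect (exists s, run e x s != 0) is left h then (run e x (ex_minn h)).-1
  else 0.

Lemma run_output e x s v : run e x s = v.+1 -> output e x = v.
Proof.
move=> Es; rewrite /output; case: pselect => [h|[]]; last by exists s; rewrite Es.
case: ex_minnP => s'; case Es': (run e x s') => [//|v'] _ _.
exact: run_fun Es' Es.
Qed.

Lemma runs_output c x y : runs c x y -> output (enc_code c) x = y.
Proof. by move=> /runs_run [s /run_output]. Qed.

(** * Computing with encoded words *)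

(* A state [npair r a] holds the codes of the rest of a word and of the reversal
   of the part already read. *)
Definition shift (st : nat) : nat :=
  if nfst st == 0 then st
  else npair (nsnd (nfst st).-1) (npair (nfst (nfst st).-1) (nsnd st)).+1.

Definition rev_take (x i : nat) : nat := nsnd (iter i shift (npair x 0)).
Definition rev_code (x : nat) : nat := rev_take x x.
Definition take_code (x i : nat) : nat := rev_code (rev_take x i).
Definition take_rcons_code (b x i : nat) : nat := rev_code (npair b (rev_take x i)).+1.
Definition size_code (x : nat) : nat :=
  \sum_(i < x) (1 - (1 - nfst (iter i shift (npair x 0)))).

Lemma shift_nil t : shift (npair 0 t) = npair 0 t.
Proof. by rewrite /shift nfst_npair. Qed.

Lemma shift_cons b s t :
  shift (npair (npair b s).+1 t) = npair s (npair b t).+1.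
Proof. by rewrite /shift !npairE. Qed.

Lemma iter_shift s t i :
  iter i shift (npair (enc_bits s) (enc_bits t)) =
  npair (enc_bits (drop i s)) (enc_bits (catrev (take i s) t)).
Proof.
elim: i s t => [|i IHi] s t; first by rewrite drop0 take0.
rewrite iterSr; case: s => [|b s]; first by rewrite shift_nil (IHi [::]).
by rewrite shift_cons -/(enc_bits (b :: t)) IHi.
Qed.

(** This lets a code serve as the number of iterations when its whole word has to be traversed. *)
Lemma size_le_enc_bits s : size s <= enc_bits s.
Proof. by elim: s => //= b s IHs; rewrite ltnS (leq_trans IHs) ?leq_npair. Qed.

Lemma rev_takeE s i : rev_take (enc_bits s) i = enc_bits (rev (take i s)).
Proof. by rewrite /rev_take (iter_shift s [::]) nsnd_npair. Qed.

Lemma rev_codeE s : rev_code (enc_bits s) = enc_bits (rev s).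
Proof. by rewrite /rev_code rev_takeE take_oversize ?size_le_enc_bits. Qed.

Lemma take_codeE s i : take_code (enc_bits s) i = enc_bits (take i s).
Proof. by rewrite /take_code rev_takeE rev_codeE revK. Qed.

Lemma take_rcons_codeE (b : bool) s i :
  take_rcons_code b (enc_bits s) i = enc_bits (rcons (take i s) b).
Proof.
rewrite /take_rcons_code rev_takeE.
by rewrite (rev_codeE (b :: rev (take i s))) rev_cons revK.
Qed.

Lemma size_codeE s : size_code (enc_bits s) = size s.
Proof.
have -> : size_code (enc_bits s) = \sum_(i < enc_bits s) (i < size s).
  apply: eq_bigr => i _; rewrite (iter_shift s [::]) nfst_npair.
  rewrite -[_ < size s]negbK -leqNgt -subn_eq0 -size_drop.
  by case: (drop i s) => //= b t; rewrite subn0.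
rewrite -[RHS](minn_idPr (size_le_enc_bits s)).
elim: (enc_bits s) => [|n IHn]; first by rewrite big_ord0 min0n.
by rewrite big_ord_recr /= IHn; case: ltnP; lia.
Qed.

Lemma computable_shift : computable id shift.
Proof. by rewrite /shift; computability. Qed.

Lemma computable_rev_take (A : Type) (enc x i : A -> nat) :
  computable enc x -> computable enc i ->
  computable enc (fun a => rev_take (x a) (i a)).
Proof.
move=> cx ci; apply: computable_nsnd; apply: computable_iter => //.
  exact: computable_shift.
by computability.
Qed.

Lemma computable_take_code (A : Type) (enc x i : A -> nat) :
  computable enc x -> computable enc i ->
  computable enc (fun a => take_code (x a) (i a)).
Proof. by move=> cx ci; do 3!apply: computable_rev_take => //. Qed.

Lemma computable_take_rcons_code (A : Type) (enc b x i : A -> nat) :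
  computable enc b -> computable enc x -> computable enc i ->
  computable enc (fun a => take_rcons_code (b a) (x a) (i a)).
Proof.
move=> cb cx ci; apply: computable_rev_take; apply: computable_S;
  apply: computable_npair => //; exact: computable_rev_take.
Qed.

Lemma computable_size_code (A : Type) (enc x : A -> nat) :
  computable enc x -> computable enc (fun a => size_code (x a)).
Proof.
move=> cx; rewrite /size_code.
apply: (computable_sum
  (F := fun a i => 1 - (1 - nfst (iter i shift (npair (x a) 0))))) => //.
apply: computable_sub; first exact: computable_const.
apply: computable_sub; first exact: computable_const.
apply: computable_nfst; apply: computable_iter; last by computability.
  exact: computable_snd2.
exact: computable_shift.
Qed.

Definition word_step (st : nat) : nat :=
  npair (nsnd (nfst st)) (npair (1 - (1 - nfst (nfst st))) (nsnd st)).+1.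

(* For fixed [l] the values [word_code m l] are exactly the codes of the words of
   length [l], with repetitions. *)
Definition word_code (m l : nat) : nat := nsnd (iter l word_step (npair m 0)).

Lemma word_code_sound m l : exists2 p, size p = l & word_code m l = enc_bits p.
Proof.
suff [p sz_p [m' Em']] : exists2 p, size p = l &
    exists m', iter l word_step (npair m 0) = npair m' (enc_bits p).
  by exists p => //; rewrite /word_code Em' nsnd_npair.
elim: l => [|l [p sz_p [m' Em']]]; first by exists [::] => //; exists m.
exists ((nfst m' != 0) :: p); first by rewrite /= sz_p.
exists (nsnd m'); rewrite iterS Em' /word_step !npairE.
by case: (nfst m').
Qed.

(** [word_step] prepends each bit that it reads, so [m] must list the bits of [p] from last to
    first. *)
Lemma word_code_complete p : exists m, word_code m (size p) = enc_bits p.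
Proof.
suff [m Em] : exists m, forall t, exists m',
    iter (size (rev p)) word_step (npair m (enc_bits t)) =
    npair m' (enc_bits (catrev (rev p) t)).
  exists m; have [m'] := Em [::]; rewrite size_rev /word_code => ->.
  by rewrite nsnd_npair -/(rev (rev p)) revK.
elim: (rev p) => [|b s [m Em]]; first by exists 0 => t; exists 0.
exists (npair b m) => t; have [m' Em'] := Em (b :: t); exists m'.
rewrite [size _]/= iterSr.
have -> : word_step (npair (npair b m) (enc_bits t)) = npair m (enc_bits (b :: t)).
  by rewrite /word_step !npairE; case: b Em'.
exact: Em'.
Qed.

Lemma computable_word_code (A : Type) (enc m l : A -> nat) :
  computable enc m -> computable enc l ->
  computable enc (fun a => word_code (m a) (l a)).
Proof.
move=> cm cl; apply: computable_nsnd; apply: computable_iter => //; last first.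
  by computability.
by rewrite /word_step; computability.
Qed.

Ltac computability_user ::=
  match goal with
  | |- computable _ (fun a => run _ _ _) => apply: computable_run
  | |- computable _ (fun a => rev_take _ _) => apply: computable_rev_take
  | |- computable _ (fun a => take_code _ _) => apply: computable_take_code
  | |- computable _ (fun a => take_rcons_code _ _ _) =>
      apply: computable_take_rcons_code
  | |- computable _ (fun a => size_code _) => apply: computable_size_code
  | |- computable _ (fun a => word_code _ _) => apply: computable_word_code
  end.

(** * Ville's inequality *)

Local Open Scope ring_scope.

Lemma sum_tupleS (V : nmodType) n (C : pred (seq bool)) (F : seq bool -> V) :
  \sum_(s : n.+1.-tuple bool | C s) F s =
  \sum_(s : n.-tuple bool | C (false :: s)) F (false :: s) +
  \sum_(s : n.-tuple bool | C (true :: s)) F (true :: s).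
Proof.
rewrite (reindex (fun u : bool * n.-tuple bool => cons_tuple u.1 u.2)) /=; last first.
  exists (fun s => (thead s, [tuple of behead s])) => [[b s] _|s _] /=.
    by congr pair; apply: val_inj.
  by apply: val_inj; case/tupleP: s => b s.
rewrite -(pair_big_dep xpredT (fun b (s : n.-tuple bool) => C (b :: s))
  (fun b (s : n.-tuple bool) => F (b :: s))) /=.
by rewrite big_bool addrC.
Qed.

Lemma sum_tuple0 (V : nmodType) (C : pred (seq bool)) (F : seq bool -> V) :
  \sum_(s : 0.-tuple bool | C s) F s = if C [::] then F [::] else 0.
Proof.
rewrite big_mkcond (big_pred1 ([tuple] : 0.-tuple bool)) // => s.
by apply/esym/eqP; apply: val_inj; case: s => -[].
Qed.

Lemma measure_sum P n x : is_measure P ->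
  \sum_(s : n.-tuple bool) P (x ++ s) = P x.
Proof.
move=> [_ _ PD]; elim: n x => [|n IHn] x.
  by rewrite (sum_tuple0 (fun=> true) (fun s => P (x ++ s))) cats0.
rewrite (sum_tupleS n (fun=> true) (fun s => P (x ++ s))) /= -PD -!IHn.
by congr (_ + _); apply: eq_bigr => s _; rewrite cat_rcons.
Qed.

(** [V] stands for a supermartingale multiplied by [P], which avoids division by zero masses. By
    induction on the depth: at a string in [S] the whole subtree is paid for by [lam * P x <= V x];
    elsewhere the two children are bounded separately and added. *)
Lemma ville P V (S : seq bool -> Prop) (lam : rat) : is_measure P -> 0 <= lam ->
  (forall x, 0 <= V x) ->
  (forall x, V (rcons x false) + V (rcons x true) <= V x) ->
  (forall x, S x -> lam * P x <= V x) ->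
  forall n x, \sum_(s : n.-tuple bool | `[< exists y, prefix y s /\ S (x ++ y) >])
    lam * P (x ++ s) <= V x.
Proof.
move=> Pmes lam_ge0 V_ge0 VD SV n x; have [_ P_ge0 _] := Pmes.
have le_V m z : S z ->
    \sum_(s : m.-tuple bool | `[< exists y, prefix y s /\ S (z ++ y) >])
      lam * P (z ++ s) <= V z.
  move=> Sz; apply: le_trans (SV z Sz).
  rewrite -(measure_sum m z Pmes) mulr_sumr.
  rewrite [leRHS](bigID
    (fun s : m.-tuple bool => `[< exists y, prefix y s /\ S (z ++ y) >])) /=.
  by rewrite lerDl; apply: sumr_ge0 => s _; apply: mulr_ge0.
elim: n x => [|n IHn] x; case: (pselect (S x)) => [/le_V //|nSx].
  rewrite (sum_tuple0 (fun s => `[< exists y, prefix y s /\ S (x ++ y) >])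
    (fun s => lam * P (x ++ s))).
  case: ifP => [/asboolP [y []]|_ //].
  by rewrite prefixs0 => /eqP -> /[!cats0].
rewrite (sum_tupleS n (fun s => `[< exists y, prefix y s /\ S (x ++ y) >])
  (fun s => lam * P (x ++ s))).
apply: le_trans (VD x).
have step b (s : seq bool) : `[< exists y, prefix y (b :: s) /\ S (x ++ y) >] =
    `[< exists y, prefix y s /\ S (rcons x b ++ y) >].
  apply/asboolP/asboolP => -[].
    case=> [[_]|b' y []]; first by rewrite cats0.
    by rewrite /= => /andP [/eqP -> pys] Sy; exists y; rewrite cat_rcons.
  by move=> y [pys Sy]; exists (b :: y); rewrite /= eqxx -cat_rcons.
have half b : \sum_(s : n.-tuple bool |
      `[< exists y, prefix y (b :: s) /\ S (x ++ y) >]) lam * P (x ++ b :: s)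
    <= V (rcons x b).
  apply: le_trans (IHn _); rewrite le_eqVlt; apply/orP; left; apply/eqP.
  by apply: eq_big => s; [exact: step | rewrite cat_rcons].
exact: lerD (half false) (half true).
Qed.

(** * A universal Martin-Löf test *)

(* Reading the pair (a, b) as a / max(1, b) makes the code of a nonnegative
   rational, which holds twice its numerator and twice its denominator,
   denote that rational, and makes every number denote some rational. *)
Definition den (v : nat) : nat := (nsnd v).-1.+1.
Definition code_frac (v : nat) : rat := (nfst v)%:R / (den v)%:R.

Lemma den_gt0 v : 0 < (den v)%:R :> rat.
Proof. by rewrite ltr0n. Qed.

Lemma code_frac_ge0 v : 0 <= code_frac v.
Proof. by rewrite divr_ge0. Qed.

Lemma code_frac_enc_rat q : 0 <= q -> code_frac (enc_rat q) = q.
Proof.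
rewrite -numq_ge0 => num_ge0.
rewrite -[RHS]divq_num_den /code_frac /den /enc_rat !npairE.
have := denq_gt0 q; case: (numq q) (denq q) num_ge0 => // a [[|b]|b] // _ _.
rewrite /enc_int -!mul2n prednK ?muln_gt0 // !natrM.
by rewrite -mulf_div divff ?mul1r // pnatr_eq0.
Qed.

(** The arguments are shifted outputs as in [run]. The terms [1 - t] keep the sum positive until all
    three runs have halted; the truncated difference is the cross-multiplied inequality between the
    three fractions. An unbounded search for a zero can then detect it. *)
Definition defect (t t0 t1 : nat) : nat :=
  ((1 - t) + (1 - t0) + (1 - t1) +
   (nfst t0.-1 * den t1.-1 * den t.-1 + nfst t1.-1 * den t0.-1 * den t.-1 -
    nfst t.-1 * den t0.-1 * den t1.-1))%N.

Lemma defect_eq0 v v0 v1 :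
  (defect v.+1 v0.+1 v1.+1 == 0)%N = (code_frac v0 + code_frac v1 <= code_frac v).
Proof.
rewrite /defect !subSS !sub0n !add0n /= subn_eq0 /code_frac.
rewrite -(ler_nat rat) !(natrD, natrM).
have := den_gt0 v; have := den_gt0 v0; have := den_gt0 v1.
move: (den v)%:R (den v0)%:R (den v1)%:R => d d0 d1 d1_gt0 d0_gt0 d_gt0.
rewrite addf_div ?gt_eqF // ler_pdivrMr ?mulr_gt0 // [_ / d * _]mulrAC ler_pdivlMr //.
by congr (_ <= _); ring.
Qed.

Definition excess (c t u : nat) : nat :=
  ((1 - t) + (1 - u) +
   ((2 ^ c * nfst u.-1 * den t.-1).+1 - nfst t.-1 * den u.-1))%N.

Lemma excess_eq0 c v u :
  (excess c v.+1 u.+1 == 0)%N = ((2 ^ c)%:R * code_frac u < code_frac v).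
Proof.
rewrite /excess !subSS !sub0n !add0n /= subn_eq0 /code_frac.
rewrite -(ltr_nat rat) !natrM.
have := den_gt0 v; have := den_gt0 u; move: (2 ^ c)%:R => C.
move: (den v)%:R (den u)%:R => d d0 d0_gt0 d_gt0.
by rewrite mulrA ltr_pdivrMr // [_ / d * _]mulrAC ltr_pdivlMr.
Qed.

Local Close Scope ring_scope.

Definition local_defect (e x s i : nat) : nat :=
  defect (run e (take_code x i) s)
    (run e (take_rcons_code 0 x i) s) (run e (take_rcons_code 1 x i) s).

Lemma computable_local_defect (A : Type) (enc e x s i : A -> nat) :
  computable enc e -> computable enc x -> computable enc s -> computable enc i ->
  computable enc (fun a => local_defect (e a) (x a) (s a) (i a)).
Proof.
by move=> *; rewrite /local_defect /defect /den; computability.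
Qed.

(** Input 0 is the code of the empty word, where the value must be at most 1. As the code [x] bounds
    the length of its word, the indices up to [x] reach every prefix, the full word included. *)
Definition search_defect (eP e k x l s : nat) : nat :=
  (1 - run e 0 s) + (nfst (run e 0 s).-1 - den (run e 0 s).-1) +
  \sum_(i < x.+1) local_defect e x s i +
  excess (k + l.*2.+1) (run e x s) (run eP x s).

Lemma computable_search_defect eP (A : Type) (enc e k x l s : A -> nat) :
  computable enc e -> computable enc k -> computable enc x ->
  computable enc l -> computable enc s ->
  computable enc (fun a => search_defect eP (e a) (k a) (x a) (l a) (s a)).
Proof.
move=> ce ck cx cl cs; rewrite /search_defect; apply: computable_add.
  apply: computable_add; first by rewrite /den; computability.
  apply: (computable_sum (F := fun a i => local_defect (e a) (x a) (s a) i)).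
    by computability.
  by apply: computable_local_defect; computability.
rewrite /excess /den; under eq_fun do rewrite -addnn.
by computability.
Qed.

(* At [z = npair (npair k x) (npair (npair m l) s)] this vanishes iff, within [s]
   steps, the machine [eU] maps the word coded by [word_code m l] to some [e] that
   behaves like a measure along the word coded by [x] and exceeds there
   2 ^ (k + 2 l + 1) times the measure computed by [eP]. *)
Definition test_fun (eU eP z : nat) : nat :=
  (1 - run eU (word_code (nfst (nfst (nsnd z))) (nsnd (nfst (nsnd z))))
         (nsnd (nsnd z))) +
  search_defect eP
    (run eU (word_code (nfst (nfst (nsnd z))) (nsnd (nfst (nsnd z))))
       (nsnd (nsnd z))).-1
    (nfst (nfst z)) (nsnd (nfst z)) (nsnd (nfst (nsnd z))) (nsnd (nsnd z)).

Lemma computable_test_fun eU eP : computable id (test_fun eU eP).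
Proof.
rewrite /test_fun; apply: computable_add; first by computability.
by apply: computable_search_defect; computability.
Qed.

Local Open Scope ring_scope.

Definition value (e : nat) (x : seq bool) : rat := code_frac (output e (enc_bits x)).

(** Only finitely many distinct values are involved, since [take i x] stabilizes at [x]; this makes
    the condition verifiable by a halting search. *)
Definition fair (e : nat) (x : seq bool) : Prop :=
  value e [::] <= 1 /\
  forall i, value e (rcons (take i x) false) + value e (rcons (take i x) true) <=
    value e (take i x).

Definition passes (eU : nat) (P : seq bool -> rat) (k : nat) (p x : seq bool) : Prop :=
  fair (output eU (enc_bits p)) x /\
  (2 ^ (k + (size p).*2.+1))%:R * P x < value (output eU (enc_bits p)) x.

Lemma value_computes c Q : is_measure Q -> computes c Q -> value (enc_code c) =1 Q.
Proof.
by move=> [_ Q_ge0 _] cQ x; rewrite /value (runs_output (cQ x)) code_frac_enc_rat.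
Qed.

Lemma run_halts e x s : (0 < run e x s)%N -> run e x s = (output e x).+1.
Proof. by case E: (run e x s) => [//|v] _; rewrite (run_output E). Qed.

Lemma local_defect_sound e x s i : local_defect e (enc_bits x) s i = 0%N ->
  value e (rcons (take i x) false) + value e (rcons (take i x) true) <=
    value e (take i x).
Proof.
rewrite /local_defect take_codeE (take_rcons_codeE false) (take_rcons_codeE true).
move=> d0; have := d0; rewrite /defect => d0'.
rewrite -defect_eq0 -!(run_halts (s := s)) ?d0 //; move: d0'; lia.
Qed.

Lemma test_sound eU cP P k j x : is_measure P -> computes cP P ->
  test_fun eU (enc_code cP) (npair (npair k (enc_bits x)) j) = 0%N ->
  exists p, passes eU P k p x.
Proof.
move=> Pmes cPP; rewrite /test_fun !npairE.
have [p <- ->] := word_code_sound (nfst (nfst j)) (nsnd (nfst j)).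
move: (nsnd j) => s /eqP; rewrite addn_eq0 => /andP [/eqP halt_p].
rewrite /= run_halts; last by move: halt_p; lia.
rewrite /= /search_defect !addn_eq0 -!andbA.
move=> /and4P [/eqP h0 init0 /eqP loc0 ex0].
exists p; rewrite /passes; move: (output _ _) loc0 h0 init0 ex0 => e loc0 h0.
rewrite run_halts /=; last by move: h0; lia.
rewrite subn_eq0 => init0 ex0; split; last first.
  rewrite -(value_computes Pmes cPP) -excess_eq0 -!(run_halts (s := s)) //;
  by move: ex0; rewrite /excess; lia.
split; first by rewrite /value /code_frac ler_pdivrMr ?den_gt0 // mul1r ler_nat.
(* Past the length of [x] every [take i x] equals [x], so the indices inspected by the search
   suffice. *)
move=> i; wlog le_i : i / (i <= enc_bits x)%N.
  move=> hw; case: (leqP i (enc_bits x)) => [/hw //|lt_i].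
  have := hw (enc_bits x) (leqnn _).
  rewrite !take_oversize ?size_le_enc_bits //.
  by rewrite (leq_trans (size_le_enc_bits x)) // ltnW.
apply: (local_defect_sound (s := s)); move/eqP: loc0.
by rewrite sum_nat_eq0 => /forallP /(_ (Ordinal (le_i : i < (enc_bits x).+1)%N)) /eqP.
Qed.

Lemma eventually_below (A : nat -> nat -> Prop) :
  (forall i s s', (s <= s')%N -> A i s -> A i s') -> (forall i, exists s, A i s) ->
  forall n, exists s, forall i, (i < n)%N -> A i s.
Proof.
move=> Amono exA; elim=> [|n [s As]]; first by exists 0%N.
have [s' As'] := exA n; exists (maxn s s') => i; rewrite ltnS leq_eqVlt.
move=> /orP [/eqP ->|/As]; first by apply: Amono As'; apply: leq_maxr.
by apply: Amono; apply: leq_maxl.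
Qed.

Lemma runs_eventually c x y : runs c x y ->
  exists s0, forall s, (s0 <= s)%N -> run (enc_code c) x s = y.+1.
Proof.
by move=> /runs_run [s0 E]; exists s0 => s le_s; apply: run_leq E.
Qed.

(** Totality of [c] makes each of the finitely many runs halt, and halted runs keep their output, so
    a common time bound [s] exists. *)
Lemma test_complete cU cP P k p x c : is_measure P -> computes cP P ->
  runs cU (enc_bits p) (enc_code c) ->
  (forall y, exists v, runs c (enc_bits y) v) ->
  passes (enc_code cU) P k p x ->
  exists j, test_fun (enc_code cU) (enc_code cP) (npair (npair k (enc_bits x)) j) = 0%N.
Proof.
move=> Pmes cPP Up c_total; rewrite /passes (runs_output Up) => -[[init loc] ex].
have [s1 Es1] := runs_eventually Up.
have halt y : exists s0, forall s, (s0 <= s)%N ->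
    run (enc_code c) (enc_bits y) s = (output (enc_code c) (enc_bits y)).+1.
  have [v rv] := c_total y; have [s0 Es0] := runs_eventually rv; exists s0 => s le_s.
  by rewrite (runs_output rv) Es0.
have [s2 Es2] := halt [::]; have [s3 Es3] := halt x.
have [s4 Es4] := runs_eventually (cPP x).
have [s5 Es5] : exists s5, forall i, (i < (enc_bits x).+1)%N -> forall s, (s5 <= s)%N ->
    local_defect (enc_code c) (enc_bits x) s i = 0%N.
  apply: (eventually_below (A := fun i s0 => forall s, (s0 <= s)%N ->
      local_defect (enc_code c) (enc_bits x) s i = 0%N)).
    by move=> i s s' le_ss' As t le_t; apply: As; apply: leq_trans le_t.
  move=> i; have [t Et] := halt (take i x).
  have [t0 Et0] := halt (rcons (take i x) false).
  have [t1 Et1] := halt (rcons (take i x) true).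
  exists (maxn t (maxn t0 t1)) => s; rewrite !geq_max => /and3P [le_t le_t0 le_t1].
  rewrite /local_defect take_codeE (take_rcons_codeE false) (take_rcons_codeE true).
  by rewrite Et // Et0 // Et1 //; apply/eqP; rewrite defect_eq0; apply: loc.
have [m Em] := word_code_complete p.
pose s := maxn s1 (maxn s2 (maxn s3 (maxn s4 s5))).
have [le1 le2 le3 le4 le5] : [/\ s1 <= s, s2 <= s, s3 <= s, s4 <= s & s5 <= s]%N.
  by rewrite /s; split; lia.
exists (npair (npair m (size p)) s).
rewrite /test_fun !npairE Em Es1 //= /search_defect (Es2 s le2) Es3 // Es4 //.
apply/eqP; rewrite /= !addn_eq0 excess_eq0 code_frac_enc_rat; last by case: Pmes.
rewrite ex !subn_eq0 /= andbT; apply/andP; split.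
  by move: init; rewrite /value /code_frac ler_pdivrMr ?den_gt0 // mul1r ler_nat.
by rewrite sum_nat_eq0; apply/forallP => i; rewrite Es5.
Qed.

(** Fairness passes to prefixes, so the cut to 0 is permanent; the result satisfies the hypotheses
    of [ville] for every number [e]. *)
Definition capital (e : nat) (x : seq bool) : rat :=
  if `[< fair e x >] then value e x else 0.

Lemma fair_rcons e x b : fair e (rcons x b) -> fair e x.
Proof.
move=> [init loc]; split=> // i.
have takeE j : (j <= size x)%N -> take j (rcons x b) = take j x.
  by move=> le_j; rewrite -cats1 takel_cat.
case: (leqP i (size x)) => [le_i|/ltnW le_i].
  by have := loc i; rewrite takeE.
by have := loc (size x); rewrite takeE // take_size (take_oversize le_i).
Qed.

Lemma capital_ge0 e x : 0 <= capital e x.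
Proof. by rewrite /capital; case: ifP => // _; apply: code_frac_ge0. Qed.

Lemma capitalD e x :
  capital e (rcons x false) + capital e (rcons x true) <= capital e x.
Proof.
rewrite {3}/capital; case: asboolP => [[init loc]|nfair]; last first.
  by rewrite /capital !asboolF ?addr0 // => /fair_rcons.
have := loc (size x); rewrite take_size; apply: le_trans.
by apply: lerD; rewrite /capital; case: ifP => // _; apply: code_frac_ge0.
Qed.

Lemma passes_mass eU P k p n : is_measure P ->
  \sum_(s : n.-tuple bool | `[< exists y, prefix y s /\ passes eU P k p y >]) P s
    <= ((2 ^ (k + (size p).*2.+1))%:R)^-1.
Proof.
move=> Pmes; set e := output eU (enc_bits p).
have := @ville P (capital e) (passes eU P k p) _ Pmes
  (ler0n _ (2 ^ (k + (size p).*2.+1))) (capital_ge0 e) (capitalD e) _ n [::].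
rewrite -mulr_sumr -ler_pdivlMl ?ltr0n ?expn_gt0 // => /(_ _)/le_trans -> //.
  by move=> x [fair_x /ltW]; rewrite /capital asboolT.
rewrite ler_piMr ?invr_ge0 //.
rewrite /capital; case: ifP => // /asboolP [init _].
exact: init.
Qed.

(** Infinitely many programs compete, but at depth [n] there are finitely many [s]: one witness
    [pr s] is chosen for each, and all witnesses are shorter than some [L]. Length [l] contributes
    at most 2^l 2^(-k-2l-1) = 2^(-k) 2^(-l-1), a geometric series. *)
Lemma union_mass eU P k n : is_measure P ->
  \sum_(s : n.-tuple bool |
      `[< exists y, prefix y s /\ exists p, passes eU P k p y >]) P s
    <= ((2 ^ k)%:R)^-1.
Proof.
move=> Pmes; have [_ P_ge0 _] := Pmes.
pose E (p : seq bool) (s : n.-tuple bool) :=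
  `[< exists y, prefix y s /\ passes eU P k p y >].
pose B (s : n.-tuple bool) :=
  `[< exists y, prefix y s /\ exists p, passes eU P k p y >].
have exE s : exists p, B s -> E p s.
  have [|nB] := boolP (B s); last by exists [::].
  by move=> /asboolP [y [pys [p Wp]]]; exists p => _; apply/asboolP; exists y.
have [pr prE] := choice exE.
pose L := (\max_(s : n.-tuple bool) size (pr s)).+1.
have lt_L s : (size (pr s) < L)%N by rewrite ltnS (leq_bigmax s).
apply: (@le_trans _ _ (\sum_(l < L) \sum_(p : l.-tuple bool)
    \sum_(s : n.-tuple bool | E p s) P s)).
  under [leRHS]eq_bigr do under eq_bigr do rewrite big_mkcond.
  under [leRHS]eq_bigr do rewrite exchange_big /=.
  rewrite exchange_big /= big_mkcond; apply: ler_sum => s _.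
  case: ifP => [Bs|_]; last first.
    by apply: sumr_ge0 => l _; apply: sumr_ge0 => p _; case: ifP.
  rewrite (bigD1 (Ordinal (lt_L s))) //= (bigD1 (in_tuple (pr s))) //=.
  rewrite prE // -addrA lerDl addr_ge0 //.
    by apply: sumr_ge0 => p _; case: ifP.
  by apply: sumr_ge0 => l _; apply: sumr_ge0 => p _; case: ifP.
apply: (@le_trans _ _ (\sum_(l < L) (2 ^ k)%:R^-1 * (2 ^ l.+1)%:R^-1)).
  apply: ler_sum => l _.
  apply: (@le_trans _ _ (\sum_(p : l.-tuple bool) ((2 ^ (k + l.*2.+1))%:R)^-1)).
    by apply: ler_sum => p _; have := passes_mass eU k p n Pmes; rewrite size_tuple.
  rewrite sumr_const card_tuple card_bool -[X in X <= _]mulr_natl.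
  rewrite -invfM -natrM ler_pdivrMr ?ltr0n ?expn_gt0 // mulrC.
  rewrite ler_pdivlMr ?ltr0n ?muln_gt0 ?expn_gt0 //.
  by rewrite -natrM ler_nat -!expnD leq_exp2l // -addnn; lia.
rewrite -mulr_sumr ler_piMr ?invr_ge0 //.
suff -> : \sum_(l < L) (2 ^ l.+1)%:R^-1 = 1 - ((2 ^ L)%:R)^-1 :> rat.
  by rewrite gerBl invr_ge0.
elim: L {lt_L} => [|m IHm]; first by rewrite big_ord0 expn0 invr1 subrr.
rewrite big_ord_recr /= IHm expnS natrM.
have : (2 ^ m)%:R != 0 :> rat by rewrite pnatr_eq0 expn_eq0.
move: (2 ^ m)%:R => z z_neq0; field.
by [].
Qed.

(** [CMu t] halts exactly when [test_fun] has a zero, so it enumerates the test; the constant [k] is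
    a level that [w] escapes. *)
Lemma universal_test U cU cP P w :
  (forall p n, U p = Some n <-> runs cU (enc_bits p) n) ->
  is_measure P -> computes cP P -> ML_random P w ->
  exists k, forall m p c, U p = Some (enc_code c) ->
    (forall y, exists v, runs c (enc_bits y) v) ->
    fair (enc_code c) (prefix_of w m) ->
    value (enc_code c) (prefix_of w m) <=
      (2 ^ (k + (size p).*2.+1))%:R * P (prefix_of w m).
Proof.
move=> cUP Pmes cPP Pw.
have [t tP] := computable_test_fun (enc_code cU) (enc_code cP).
have testP k x : test_set (CMu t) k x <->
    exists j,
      test_fun (enc_code cU) (enc_code cP) (npair (npair k (enc_bits x)) j) = 0%N.
  by apply: runs_mu => j; apply: tP.
have [|k nk] := Pw (CMu t).
  move=> k n; apply: le_trans (union_mass (enc_code cU) k n Pmes).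
  have [_ P_ge0 _] := Pmes.
  rewrite big_mkcond [leRHS]big_mkcond; apply: ler_sum => s _.
  case: ifP => [/asboolP [y [pys /testP [j]]]|_]; last by case: ifP.
  move=> /(test_sound Pmes cPP) [p Wp].
  by rewrite asboolT //; exists y; split => //; exists p.
exists k => m p c /cUP Up c_total fair_m; rewrite leNgt; apply/negP => gt_m.
apply: (nk m); apply/testP; apply: (test_complete Pmes cPP Up c_total).
by rewrite /passes (runs_output Up).
Qed.

(** * Averaging the predictions of two measures *)

(* The average of P y' / P y and Q y' / Q y, except that it is 0 whenever [P y] or
   [Q y] is 0. *)
Definition mean_cond (P Q : seq bool -> rat) (y y' : seq bool) : rat :=
  (P y' * Q y + Q y' * P y) / (2 * P y * Q y).

Definition blend (P Q : seq bool -> rat) (x : seq bool) : rat :=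
  \prod_(i < size x) mean_cond P Q (take i x) (take i.+1 x).

Lemma blend_rcons P Q x b :
  blend P Q (rcons x b) = blend P Q x * mean_cond P Q x (rcons x b).
Proof.
rewrite /blend size_rcons big_ord_recr /=; congr (_ * mean_cond _ _ _ _).
- apply: eq_bigr => i _; have := ltn_ord i => lt_i.
  by rewrite -cats1 !takel_cat // ltnW.
- by rewrite -cats1 takel_cat // take_size.
- by rewrite take_oversize // size_rcons.
Qed.

Lemma mean_cond_ge0 P Q y y' : is_measure P -> is_measure Q ->
  0 <= mean_cond P Q y y'.
Proof.
move=> [_ P_ge0 _] [_ Q_ge0 _]; rewrite /mean_cond divr_ge0 //.
  by rewrite addr_ge0 // mulr_ge0.
by rewrite !mulr_ge0.
Qed.

Lemma blend_ge0 P Q x : is_measure P -> is_measure Q -> 0 <= blend P Q x.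
Proof. by move=> Pm Qm; apply: prodr_ge0 => i _; apply: mean_cond_ge0. Qed.

(** The two factors [mean_cond] at [x] add up to 1, or are both 0 when the denominator vanishes;
    only in the second case can mass be lost. *)
Lemma blendD P Q x : is_measure P -> is_measure Q ->
  blend P Q (rcons x false) + blend P Q (rcons x true) <= blend P Q x.
Proof.
move=> Pm Qm; rewrite !blend_rcons -mulrDr ler_piMr ?blend_ge0 //.
case: Pm Qm => [_ _ PD] [_ _ QD]; rewrite /mean_cond -mulrDl.
have -> : P (rcons x false) * Q x + Q (rcons x false) * P x +
    (P (rcons x true) * Q x + Q (rcons x true) * P x) = 2 * P x * Q x.
  by rewrite -[in RHS](PD x) -[in LHS](QD x) -[in LHS](PD x) -(QD x); ring.
by have [->|nz] := eqVneq (2 * P x * Q x) 0; rewrite ?mul0r // divff.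
Qed.

Definition gap (P Q : seq bool -> rat) (eps : rat) (x : seq bool) : bool :=
  eps <= `|cond Q false x - cond P false x|.

(* AM-GM with remainder: ((p + q)/2)^2 = p q + ((p - q)/2)^2 and p q <= 1. *)
Lemma mean_cond_sqr P Q eps x b : is_measure P -> is_measure Q -> 0 <= eps ->
  0 < P x -> 0 < Q x ->
  (1 + eps ^+ 2 / 4) ^+ gap P Q eps x * (P (rcons x b) * Q (rcons x b)) <=
  P x * Q x * mean_cond P Q x (rcons x b) ^+ 2.
Proof.
move=> [_ P_ge0 PD] [_ Q_ge0 QD] eps_ge0 Px Qx.
pose p b := P (rcons x b) / P x; pose q b := Q (rcons x b) / Q x.
have Pp c : P (rcons x c) = p c * P x by rewrite /p divfK ?gt_eqF.
have Qq c : Q (rcons x c) = q c * Q x by rewrite /q divfK ?gt_eqF.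
have p_ge0 c : 0 <= p c by rewrite divr_ge0 // ltW.
have q_ge0 c : 0 <= q c by rewrite divr_ge0 // ltW.
have p_sum : p false + p true = 1 by rewrite /p -mulrDl PD divff ?gt_eqF.
have q_sum : q false + q true = 1 by rewrite /q -mulrDl QD divff ?gt_eqF.
have -> : mean_cond P Q x (rcons x b) = (p b + q b) / 2.
  by rewrite /mean_cond Pp Qq; field; rewrite !gt_eqF.
have -> : (1 + eps ^+ 2 / 4) ^+ gap P Q eps x * (P (rcons x b) * Q (rcons x b)) =
    P x * Q x * ((1 + eps ^+ 2 / 4) ^+ gap P Q eps x * (p b * q b)).
  by rewrite Pp Qq; move: (_ ^+ gap _ _ _ _) => c; ring.
rewrite ler_pM2l ?mulr_gt0 //.
have pq_ge0 : 0 <= p b * q b by rewrite mulr_ge0.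
have pq_le1 : p b * q b <= 1.
  have := p_ge0 true; have := p_ge0 false; have := q_ge0 true; have := q_ge0 false.
  by move=> *; apply: mulr_ile1 => //; case: (b); lra.
have -> : ((p b + q b) / 2) ^+ 2 = p b * q b + (p b - q b) ^+ 2 / 4 by field.
rewrite /gap; case: (leP eps) => [|_] /=; last first.
  by rewrite mul1r lerDl divr_ge0 ?sqr_ge0.
have -> : cond Q false x - cond P false x = q false - p false by [].
(* Predictions of the two bits add up to 1, so a gap at bit 0 is an equal gap at bit 1. *)
have -> : `|q false - p false| = `|p b - q b|.
  case: (b); last exact: distrC.
  by congr (`|_|); lra.
move=> le_eps; rewrite mulrDl mul1r lerD2l.
have le_sqr : eps ^+ 2 <= (p b - q b) ^+ 2.
  by rewrite -[leRHS]real_normK ?num_real // lerXn2r // nnegrE.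
have := mulr_ge0 (sqr_ge0 eps) (_ : 0 <= 1 - p b * q b).
rewrite subr_ge0 => /(_ pq_le1).
by move: (p b * q b) ((p b - q b) ^+ 2) (eps ^+ 2) le_sqr => u v e; lra.
Qed.

(** The one-step estimates are multiplied along [w]. In this quotient-free form zero masses are
    harmless: they persist and annihilate the left side. *)
Lemma blend_growth P Q eps w n : is_measure P -> is_measure Q -> 0 <= eps ->
  (1 + eps ^+ 2 / 4) ^+ (\sum_(i < n) gap P Q eps (prefix_of w i))%N *
    (P (prefix_of w n) * Q (prefix_of w n)) <= blend P Q (prefix_of w n) ^+ 2.
Proof.
move=> Pm Qm eps_ge0; have [P1 P_ge0 PD] := Pm; have [Q1 Q_ge0 QD] := Qm.
elim: n => [|n IHn].
  by rewrite big_ord0 /prefix_of /= /blend big_ord0 P1 Q1 !expr1n expr0 !mul1r.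
rewrite /prefix_of mkseqS -/(prefix_of w n); set x := prefix_of w n; set b := w n.
have le_rcons (S : seq bool -> rat) : is_measure S -> S (rcons x b) <= S x.
  by move=> [_ S_ge0 SD]; rewrite -(SD x); case: b; rewrite ?lerDl ?lerDr.
have zero_rcons (S : seq bool -> rat) : is_measure S -> S x = 0 -> S (rcons x b) = 0.
  move=> Sm Sx; apply/eqP; rewrite eq_le -{1}Sx le_rcons //.
  by case: Sm => _ ->.
have sqr0 : 0 <= blend P Q (rcons x b) ^+ 2 by apply: sqr_ge0.
have [Px|Px] := eqVneq (P x) 0; first by rewrite (zero_rcons P) // mul0r mulr0.
have [Qx|Qx] := eqVneq (Q x) 0; first by rewrite (zero_rcons Q) // !mulr0.
have {}Px : 0 < P x by rewrite lt0r Px P_ge0.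
have {}Qx : 0 < Q x by rewrite lt0r Qx Q_ge0.
rewrite big_ord_recr /= exprD -/x blend_rcons exprMn -mulrA.
have := mean_cond_sqr b Pm Qm eps_ge0 Px Qx.
have base_ge0 : 0 <= 1 + eps ^+ 2 / 4 by rewrite addr_ge0 // divr_ge0 ?sqr_ge0.
move/(ler_wpM2l (exprn_ge0 (\sum_(i < n) gap P Q eps (prefix_of w i)) base_ge0)).
move/le_trans; apply.
by rewrite mulrA ler_wpM2r ?sqr_ge0.
Qed.

(** [code_frac] reads a denominator 0 as 1, whereas division by 0 gives 0; the hypothesis makes the
    numerator vanish too, so both readings agree. *)
Lemma code_frac_prod n (a d : nat -> nat) : (forall i, d i = 0 -> a i = 0)%N ->
  code_frac (npair (\prod_(i < n) a i)%N (\prod_(i < n) d i)%N) =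
  \prod_(i < n) ((a i)%:R / (d i)%:R).
Proof.
move=> ad; rewrite /code_frac /den !npairE.
case: (boolP [exists i : 'I_n, d i == 0%N]) => [/existsP [i /eqP di]|].
  have -> : (\prod_(i < n) a i)%N = 0%N by rewrite (bigD1 i) //= ad // mul0n.
  by rewrite mul0r (bigD1 i) //= ad // mul0r mul0r.
rewrite negb_exists => /forallP d_neq0.
rewrite prednK; last by apply: prodn_gt0 => i; rewrite lt0n.
by rewrite !natr_prod prodf_div.
Qed.

Lemma enc_rat_fraction q : 0 <= q ->
  [/\ (0 < nsnd (enc_rat q))%N & q = (nfst (enc_rat q))%:R / (nsnd (enc_rat q))%:R].
Proof.
move=> q_ge0; have d_gt0 : (0 < nsnd (enc_rat q))%N.
  rewrite /enc_rat nsnd_npair; have := denq_gt0 q.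
  by case: (denq q) => // -[|d].
by rewrite -{2}(code_frac_enc_rat q_ge0) /code_frac /den prednK.
Qed.

(** Clearing the denominators of the four rationals in [mean_cond] leaves natural numbers, so
    [blend] is obtained from integer products. The fraction stays unreduced and is read by
    [code_frac]. *)
Definition blend_num (P Q : seq bool -> rat) (x : seq bool) (i : nat) : nat :=
  (nfst (enc_rat (P (take i.+1 x))) * nsnd (enc_rat (P (take i x))) *
   nfst (enc_rat (Q (take i x))) * nsnd (enc_rat (Q (take i.+1 x))) +
   nfst (enc_rat (Q (take i.+1 x))) * nsnd (enc_rat (Q (take i x))) *
   nfst (enc_rat (P (take i x))) * nsnd (enc_rat (P (take i.+1 x))))%N.

Definition blend_den (P Q : seq bool -> rat) (x : seq bool) (i : nat) : nat :=
  (2 * nsnd (enc_rat (P (take i.+1 x))) * nfst (enc_rat (P (take i x))) *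
   nsnd (enc_rat (Q (take i.+1 x))) * nfst (enc_rat (Q (take i x))))%N.

Lemma blend_num_den P Q x i : is_measure P -> is_measure Q ->
  (blend_den P Q x i = 0%N -> blend_num P Q x i = 0%N) /\
  (blend_num P Q x i)%:R / (blend_den P Q x i)%:R =
    mean_cond P Q (take i x) (take i.+1 x).
Proof.
move=> Pm Qm; have [_ P_ge0 PD] := Pm; have [_ Q_ge0 QD] := Qm.
rewrite /blend_den /blend_num /mean_cond.
have zero_take (S : seq bool -> rat) : is_measure S ->
    S (take i x) = 0 -> S (take i.+1 x) = 0.
  move=> [_ S_ge0 SD] S0; case: (leqP (size x) i) => [le_i|lt_i].
    by move: S0; rewrite !take_oversize // ltnW // ltnS.
  rewrite (take_nth false) //; apply/eqP.
  rewrite eq_le S_ge0 andbT -{1}S0 -(SD (take i x)).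
  by case: (nth _ _ _); rewrite ?lerDl ?lerDr.
have [pd1 p1] := enc_rat_fraction (P_ge0 (take i.+1 x)).
have [pd p] := enc_rat_fraction (P_ge0 (take i x)).
have [qd1 q1] := enc_rat_fraction (Q_ge0 (take i.+1 x)).
have [qd q] := enc_rat_fraction (Q_ge0 (take i x)).
have := zero_take P Pm; have := zero_take Q Qm.
move: (enc_rat (P (take i.+1 x))) (enc_rat (P (take i x))) pd1 p1 pd p.
move=> u' u u'd -> ud ->.
move: (enc_rat (Q (take i.+1 x))) (enc_rat (Q (take i x))) qd1 q1 qd q.
move=> v' v v'd -> vd ->.
have fracE a d : (0 < d)%N -> (a%:R / d%:R == 0 :> rat) = (a == 0%N).
  by move=> d_gt0; rewrite mulf_eq0 invr_eq0 !pnatr_eq0 [d == _]gtn_eqF ?orbF.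
move=> v0 u0.
have {}v0 : nfst v = 0%N -> nfst v' = 0%N.
  by move/eqP; rewrite -(fracE _ _ vd) => /eqP /v0 /eqP; rewrite fracE // => /eqP.
have {}u0 : nfst u = 0%N -> nfst u' = 0%N.
  by move/eqP; rewrite -(fracE _ _ ud) => /eqP /u0 /eqP; rewrite fracE // => /eqP.
split.
  case: (posnP (nfst u)) => [E _|u_gt0]; first by rewrite E (u0 E) !(mul0n, muln0).
  case: (posnP (nfst v)) => [E _|v_gt0]; first by rewrite E (v0 E) !(mul0n, muln0).
  by move/eqP; rewrite eqn0Ngt !muln_gt0 u_gt0 v_gt0 u'd v'd.
have [u_0|u_neq0] := eqVneq (nfst u) 0%N.
  by rewrite u_0 !(mul0r, mulr0, muln0, mul0n, invr0).
have [v_0|v_neq0] := eqVneq (nfst v) 0%N.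
  by rewrite v_0 !(mul0r, mulr0, muln0, mul0n, invr0).
rewrite !(natrD, natrM); field.
by rewrite !pnatr_eq0 u_neq0 v_neq0 -!lt0n ud vd u'd v'd.
Qed.

Lemma computable_enc_rat_take c S : computes c S ->
  computable (enc2 enc_bits) (fun u => enc_rat (S (take u.2 u.1))) /\
  computable (enc2 enc_bits) (fun u => enc_rat (S (take u.2.+1 u.1))).
Proof.
move=> cS; have cSx : computable enc_bits (fun x => enc_rat (S x)) by exists c.
split.
  apply: (computable_comp_enc (h := fun u => take u.2 u.1) cSx).
  apply: (computable_ext (f := fun u => take_code (enc_bits u.1) u.2)) => [u|].
    exact: take_codeE.
  apply: computable_take_code; last exact: computable_snd2.
  exact/computable_lift2/computable_enc.
apply: (computable_comp_enc (h := fun u => take u.2.+1 u.1) cSx).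
apply: (computable_ext (f := fun u => take_code (enc_bits u.1) u.2.+1)) => [u|].
  exact: take_codeE.
apply: computable_take_code; last exact/computable_S/computable_snd2.
exact/computable_lift2/computable_enc.
Qed.

Lemma blend_computable P Q : computable_measure P -> computable_measure Q ->
  exists c, (forall y, exists v, runs c (enc_bits y) v) /\
    value (enc_code c) =1 blend P Q.
Proof.
move=> [Pm [cP cPP]] [Qm [cQ cQQ]].
have [P0 P1] := computable_enc_rat_take cPP.
have [Q0 Q1] := computable_enc_rat_take cQQ.
have csize : computable enc_bits (fun x => size x).
  apply: (computable_ext (f := fun x => size_code (enc_bits x))) => [x|].
    exact: size_codeE.
  exact/computable_size_code/computable_enc.
have [c cE] : computable enc_bits (fun x => npair
    (\prod_(i < size x) blend_num P Q x i)%N (\prod_(i < size x) blend_den P Q x i)%N).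
  apply: computable_npair; apply: computable_prod => //;
    by rewrite /blend_num /blend_den; computability.
exists c; split=> [y|x]; first by exists (npair
    (\prod_(i < size y) blend_num P Q y i)%N (\prod_(i < size y) blend_den P Q y i)%N).
rewrite /value (runs_output (cE x)) code_frac_prod => [|i]; last first.
  exact: (blend_num_den x i Pm Qm).1.
by apply: eq_bigr => i _; exact: (blend_num_den x i Pm Qm).2.
Qed.

(** * Best explanations along a random sequence *)

(** Optimality is applied to the prefix-free machine defined on the empty word only, with output
    [n]. *)
Lemma optimal_onto U n : optimal_prefix_machine U -> exists p, U p = Some n.
Proof.
move=> [_ _ U_opt].
have [c cE] : computable id (fun=> n) by apply: computable_const.
have [d dE] : computable id nfst by exists CFst => a; exists 1%N.
have [||k Uk] := U_opt (fun p => if p is [::] then Some n else None).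
- by case=> [|? ?] [|? ?].
(* [d] ignores the search index and returns the input, so [CMu d] halts only on 0, the code of the
   empty word. *)
- exists (CComp c (CMu d)) => p m.
  have muP : (exists y, runs (CMu d) (enc_bits p) y) <->
      exists j : nat, enc_bits p = 0%N.
    by apply: runs_mu => i; have := dE (npair (enc_bits p) i); rewrite nfst_npair.
  split=> [|[[//|t] /=]].
    case: p muP => // muP [<-]; have [|y mu_y] := muP.2; first by exists 0%N.
    exact: runs_comp mu_y (cE y).
  case Emu: (eval t (CMu d) (enc_bits p)) => [y|] //= Ec.
  have -> : m = n by apply: (runs_fun _ (cE y)); exists t.
  have [|_] := muP.1; first by exists y, t.
  by case: p {muP Emu}.
by have [p [Up _]] := Uk [::] n erefl; exists p.
Qed.

Lemma KQ_exists U Q : optimal_prefix_machine U -> computable_measure Q ->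
  exists k, KQ U Q k.
Proof.
move=> Uopt [_ [c cQ]]; have [p Up] := optimal_onto (enc_code c) Uopt.
have exk : exists k,
    `[< exists c p, computes c Q /\ U p = Some (enc_code c) /\ size p = k >].
  by exists (size p); apply/asboolP; exists c, p.
case: (ex_minnP exk) => k /asboolP ex_k k_min; exists k; split=> // c' p' cQ' Up'.
by apply: k_min; apply/asboolP; exists c', p'.
Qed.

Lemma score_le k1 k2 (q1 q2 : rat) : 0 < q1 -> 0 < q2 ->
  score k1 q1 <= score k2 q2 ->
  (2 ^ (3 * k1))%:R * q2 <= (2 ^ (3 * k2))%:R * q1.
Proof.
move=> q1_gt0 q2_gt0; rewrite /score /log2.
have ln2_gt0 : 0 < ln 2 :> R.
  by apply/RltP; apply: Rlt_trans (Rinv_0_lt_compat _ Rlt_0_2) ln_lt_2.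
have lnE k (q : rat) : 0 < q ->
    ln (ratr ((2 ^ (3 * k))%:R * q)) = 3 * INR k * ln 2 + ln (ratr q) :> R.
  move=> q_gt0; rewrite rmorphM /= ratr_nat.
  have -> : (2 ^ (3 * k))%:R = pow (IZR 2) (3 * k) :> R.
    by rewrite natrX -RpowE; congr (pow _ _); rewrite -INRE.
  rewrite -[GRing.mul _ _]/(Rmult _ _) ln_mult.
  - rewrite ln_pow; last exact: Rlt_0_2.
    by rewrite mult_INR INRE.
  - exact: pow_lt Rlt_0_2.
  - by apply/RltP; rewrite ltr0q.
move=> le_score; rewrite -(ler_rat R) leNgt; apply/negP => /RltP /ln_increasing.
have pos k (q : rat) : 0 < q -> Rlt 0 (ratr ((2 ^ (3 * k))%:R * q)).
  by move=> q_gt0; apply/RltP; rewrite ltr0q mulr_gt0 // ltr0n expn_gt0.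
move=> /(_ (pos _ _ q1_gt0)) /RltP; rewrite !lnE //; apply/negP; rewrite -leNgt.
move: le_score; move: (ln (ratr q1)) (ln (ratr q2)) => a b.
rewrite lerBlDr -addrA [- _ + _]addrC addrA lerBrDr.
rewrite -(ler_pM2r ln2_gt0) !mulrDl !divfK ?gt_eqF //.
Qed.

Lemma infinite_pigeonhole (T : finType) (A : T -> nat -> Prop) :
  (forall N, exists2 n, (N <= n)%N & exists t, A t n) ->
  exists t, forall N, exists2 n, (N <= n)%N & A t n.
Proof.
move=> infA; apply: contrapT => none.
have bound t : exists N, forall n, (N <= n)%N -> ~ A t n.
  apply: contrapT => nb; apply: none; exists t => N.
  apply: contrapT => nn; apply: nb; exists N => n le_n At; apply: nn.
  by exists n.
have [f fP] := choice bound.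
have [n le_n [t At]] := infA (\max_t f t)%N.
by apply: fP At; apply: leq_trans le_n; apply: leq_bigmax.
Qed.

Lemma bernoulli (d : rat) n : 0 <= d -> 1 + n%:R * d <= (1 + d) ^+ n.
Proof.
move=> d_ge0; elim: n => [|n IHn]; first by rewrite mul0r addr0 expr0.
rewrite exprS; apply: (@le_trans _ _ ((1 + d) * (1 + n%:R * d))).
  have -> : (1 + d) * (1 + n%:R * d) = 1 + n.+1%:R * d + n%:R * d ^+ 2.
    by rewrite -natr1; ring.
  by rewrite lerDl mulr_ge0 // sqr_ge0.
by rewrite ler_wpM2l // addr_ge0.
Qed.

Lemma rat_below (eps : R) : Rlt 0 eps -> exists2 d : rat, 0 < d & ratr d <= eps.
Proof.
move=> eps_gt0; have [N [lt_N N_gt0]] := archimed_cor1 _ eps_gt0.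
exists (N%:R^-1); first by rewrite invr_gt0 ltr0n; apply/ssrnat.ltP.
rewrite fmorphV /= ratr_nat -INRE; apply: ltW; apply/RltP.
by rewrite -RinvE.
Qed.

(** [S] collects the lengths at which [Q] explains the prefix and a gap occurs. Each of them raises
    [g], so [g] is arbitrarily large at members of [S], where the lower bound on [Q] is
    available. *)
Lemma prefix_gap_bounded P Q w eps (S : nat -> Prop) (C : nat) :
  is_measure P -> is_measure Q -> 0 < eps ->
  (forall n, 0 < P (prefix_of w n)) ->
  (forall n, blend P Q (prefix_of w n) <= (2 ^ C)%:R * P (prefix_of w n)) ->
  (forall n, S n -> P (prefix_of w n) <= (2 ^ C)%:R * Q (prefix_of w n) /\
    gap P Q eps (prefix_of w n)) ->
  ~ forall N, exists2 n, (N <= n)%N & S n.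
Proof.
move=> Pm Qm eps_gt0 P_gt0 le_blend SP S_inf.
pose g n := (\sum_(i < n) gap P Q eps (prefix_of w i))%N.
pose d := eps ^+ 2 / 4.
have d_gt0 : 0 < d by rewrite divr_gt0 // exprn_gt0.
have g_le m n : (m <= n)%N -> (g m <= g n)%N.
  move=> /subnK <-; elim: (n - m)%N => [//|k IHk].
  by rewrite addSn /g big_ord_recr /=; apply: leq_trans IHk (leq_addr _ _).
have g_inf m : exists2 n, S n & (m <= g n)%N.
  elim: m => [|m [n Sn le_m]].
    by have [n _ Sn] := S_inf 0%N; exists n.
  have [n' lt_nn' Sn'] := S_inf n.+1; exists n' => //.
  apply: leq_trans (g_le _ _ lt_nn'); rewrite /g big_ord_recr /= (SP n Sn).2 addn1.
  exact: le_m.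
(* The cube: two factors 2^C from the squared bound on [blend], one from P <= 2^C Q. By Bernoulli,
   (1 + d)^g exceeds it once g > 2^(3C) / d. *)
have [n Sn le_g] := g_inf (Num.Def.truncn ((2 ^ C)%:R ^+ 3 / d : rat)).+1.
have [le_PQ _] := SP n Sn.
have Qn_gt0 : 0 < Q (prefix_of w n).
  have := lt_le_trans (P_gt0 n) le_PQ.
  by rewrite pmulr_rgt0 // ltr0n expn_gt0.
have pow_le : (1 + d) ^+ g n <= (2 ^ C)%:R ^+ 3.
  have := blend_growth w n Pm Qm (ltW eps_gt0); rewrite -/(g n) -/d.
  have : blend P Q (prefix_of w n) ^+ 2 <= ((2 ^ C)%:R * P (prefix_of w n)) ^+ 2.
    by rewrite lerXn2r ?nnegrE ?blend_ge0 // mulr_ge0 // ltW.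
  move: le_PQ (P_gt0 n) Qn_gt0.
  move: (P _) (Q _) (blend _ _ _) ((1 + d) ^+ g n) => p q b G le_pq p_gt0 q_gt0 le1 le2.
  have {le1 le2} := le_trans le2 le1.
  rewrite exprMn [p ^+ 2]expr2 mulrCA [_ * (p * p)]mulrCA ler_pM2l // => le_Gq.
  rewrite -(ler_pM2r q_gt0); apply: le_trans le_Gq _.
  by rewrite [_ ^+ 3]exprSr -[leRHS]mulrA ler_wpM2l // exprn_ge0.
have := le_trans (bernoulli (g n) (ltW d_gt0)) pow_le; apply/negP; rewrite -ltNge.
apply: (@lt_le_trans _ _ ((g n)%:R * d)); last by rewrite lerDr.
rewrite -ltr_pdivrMr //.
apply: lt_le_trans (truncnS_gt _) _.
by rewrite ler_nat.
Qed.

(** The inequalities asked of [Q] cover both uses: best explanations, where they are equalities, and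
    [blend]. *)
Lemma random_bound U P w : optimal_prefix_machine U -> computable_measure P ->
  ML_random P w ->
  exists k, forall m p c Q, U p = Some (enc_code c) ->
  (forall y, exists v, runs c (enc_bits y) v) -> value (enc_code c) =1 Q ->
  Q [::] <= 1 -> (forall x, Q (rcons x false) + Q (rcons x true) <= Q x) ->
  Q (prefix_of w m) <= (2 ^ (k + (size p).*2.+1))%:R * P (prefix_of w m).
Proof.
move=> [_ [cU cUP] _] [Pm [cP cPP]] Pw.
have [k kP] := universal_test cUP Pm cPP Pw; exists k => m p c Q Up c_total cQ Q1 QD.
by rewrite -cQ; apply: kP => //; split=> [|i]; rewrite !cQ.
Qed.

(* Combining 2^(3K(Q)) P(x) <= 2^(3K(P)) Q(x) with Q(x) <= O(2^(2K(Q))) P(x)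
   bounds K(Q). *)
Lemma explanation_bound U P w H : optimal_prefix_machine U ->
  computable_measure P -> ML_random P w -> (forall x, best_explanation U x (H x)) ->
  exists B C, forall n,
    0 < P (prefix_of w n) /\
    exists c p, [/\ computes c (H (prefix_of w n)), U p = Some (enc_code c),
      (size p <= B)%N &
      P (prefix_of w n) <= (2 ^ C)%:R * H (prefix_of w n) (prefix_of w n)].
Proof.
move=> HU HP Hw HH; have [k kP] := random_bound HU HP Hw.
have [KP KPP] := KQ_exists HU HP.
(* The two bounds combine to 3K <= 3 KP + k + 2K + 1, that is K <= 3 KP + k + 1. *)
exists (3 * KP + k + 1)%N, (3 * KP)%N => n.
have {kP} := kP n; move: (prefix_of w n) => x kP.
have [[Hm _] [Hx_gt0 [K [[[c [p [cH [Up <-]]]] _] Hmin]]]] := HH x.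
have [H1 H_ge0 HD] := Hm.
have le_H : H x x <= (2 ^ (k + (size p).*2.+1))%:R * P x.
  apply: (kP p c (H x)) => //.
  - by move=> y; exists (enc_rat (H x y)).
  - exact: value_computes.
  - by rewrite H1.
  - by move=> y; rewrite HD.
(* Positivity is inherited from [H x x], and only then does [P] compete in the minimization. *)
have Px_gt0 : 0 < P x.
  by have := lt_le_trans Hx_gt0 le_H; rewrite pmulr_rgt0 // ltr0n expn_gt0.
have le_score := score_le Hx_gt0 Px_gt0 (Hmin P KP HP KPP Px_gt0).
split=> //; exists c, p; split=> //.
  have := le_trans le_score (ler_wpM2l (ler0n _ _) le_H).
  by rewrite mulrA ler_pM2r // -natrM ler_nat -expnD leq_exp2l // -addnn; lia.
by apply: le_trans le_score; rewrite ler_peMl // ?(ltW Px_gt0) // ler1n expn_gt0.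
Qed.

Local Close Scope ring_scope.

Theorem theorem4 (U : machine) (HU : optimal_prefix_machine U)
  (P : seq bool -> rat) (HP : computable_measure P)
  (w : nat -> bool) (Hw : ML_random P w)
  (H : seq bool -> (seq bool -> rat))
  (HH : forall x, best_explanation U x (H x)) :
  forall eps : R, Rlt 0 eps ->
    exists N : nat, forall n : nat, (N <= n)%nat ->
      Rlt (Rabs (Rminus (ratr (cond (H (prefix_of w n)) false (prefix_of w n)))
                        (ratr (cond P false (prefix_of w n))))) eps.
Proof.
move=> eps eps_gt0; have [d d_gt0 le_d] := rat_below eps_gt0.
apply: contrapT => no_limit; have [Pm _] := HP.
have gap_inf N : exists2 n, N <= n & gap P (H (prefix_of w n)) d (prefix_of w n).
  apply: contrapT => no_gap; apply: no_limit; exists N => n le_n.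
  rewrite RminusE RabsE; apply/RltP; rewrite -rmorphB -ratr_norm.
  apply: lt_le_trans le_d; rewrite ltr_rat ltNge; apply/negP => gap_n.
  by apply: no_gap; exists n.
have [B [C BC]] := explanation_bound HU HP Hw HH.
(* Programs of length at most [B] form a finite type, unlike measures, so the pigeonhole is applied
   to them. *)
pose A (p : B.-bseq bool) n := exists c, [/\ computes c (H (prefix_of w n)),
  U p = Some (enc_code c),
  (P (prefix_of w n) <= (2 ^ C)%:R * H (prefix_of w n) (prefix_of w n))%R &
  gap P (H (prefix_of w n)) d (prefix_of w n)].
have [|p Ap] := @infinite_pigeonhole _ A.
  move=> N; have [n le_n gap_n] := gap_inf N; exists n => //.
  have [_ [c [p [cH Up le_B le_P]]]] := BC n.
  by exists (Bseq le_B), c.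
have [n0 _ [c0 [cH0 Up0 _ _]]] := Ap 0; pose Q := H (prefix_of w n0).
have [[Qm Q_comp] _] := HH (prefix_of w n0).
(* The output of [U] on [p] fixes the code number, and this number fixes all values of the
   measure. *)
have HQ c n : computes c (H (prefix_of w n)) -> U p = Some (enc_code c) ->
    H (prefix_of w n) = Q.
  rewrite Up0 => cH [Ec]; apply: funext => x.
  have [[Hm _] _] := HH (prefix_of w n).
  by rewrite -(value_computes Hm cH) -Ec (value_computes Qm cH0).
have [k kP] := random_bound HU HP Hw.
have [c [c_total cR]] := blend_computable HP (conj Qm Q_comp).
have [p' Up'] := optimal_onto (enc_code c) HU.
apply: (@prefix_gap_bounded P Q w d (A p) (C + (k + (size p').*2.+1))) => //.
- by move=> n; have [] := BC n.
- move=> n; apply: le_trans (kP n p' c _ Up' c_total cR _ _) _.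
  + by rewrite /blend big_ord0.
  + by move=> x; apply: blendD.
  + by have [Pn _] := BC n; rewrite ler_pM2r // ler_nat leq_exp2l // leq_addl.
- move=> n [c' [cH Up le_P gap_n]]; rewrite -(HQ c' n) //; split=> //.
  apply: le_trans le_P _; have [_ [Hx_gt0 _]] := HH (prefix_of w n).
  by rewrite ler_pM2r // ler_nat leq_exp2l // leq_addr.
Qed.
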